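(* Let $L\subseteq\mathbb R^n$ be a convex body and $K\in\mathscr K(\mathbb R^n)$ such that $K\subseteq L$. Let $\mu=(\mu_j)_{j\ge1}$ be an admissible weight satisfying $\mu_j\ge j$ for $j\ge1$. Let $M_0>b_0>0$. Assume that $(\mu,M_0,a_K,b_0)$ is admissible and let $\mathbf N=\mathbf N(\mu,M_0,a_K,b_0)$. Let $f:L\to\mathbb R$ be a $(\mu^{|\mathbf N},M_0)$-smooth function satisfying $\|f\|_K\ge b_0$. Then the integral $$\int_K|f(x)|^{-\alpha}\,dx$$ converges, provided that $0<\alpha<1/\mathbf N$.
   Context: $|E|$ denotes Lebesgue measure. A convex body is a compact convex set with nonempty interior. Weights and smoothness. An admissible weight is a sequence $\mu=(\mu_j)_{j\ge1}$ of reals with $0<\mu_1\le\mu_2\le\cdots$. Given $M_0>0$ put $M_j=M_0\mu_1\cdots\mu_j$, $j\ge1$. For $N\in\mathbb N_{\ge1}\cup\{\infty\}$ and nonempty compact $L\subseteq\mathbb R^n$, a function $f:L\to\mathbb R$ is $(\mu^{|N},M_0)$-smooth if it is of class $C^N$ in some open neighborhood of $L$ and $\sup_{x\in L}\sum_{|\alpha|=j}\frac{j!}{\alpha!}|\partial^\alpha f(x)|\le M_j$ for all integers $0\le j<N+1$. Also $\|f\|_E:=\sup_{x\in E}|f(x)|$. Degree. For $A,a,b>0$ let $j_0$ be the smallest nonnegative integer $\ge\log(A/b)$. The tuple $(\mu,A,a,b)$ is admissible if $\sum_{j=j_0+1}^\infty 1/\mu_j>a\,e$; then $\mathbf N(\mu,A,a,b):=2\sup\{k\in\mathbb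 N:\sum_{j=j_0+1}^k\frac1{a\mu_j}<e\}$ (empty sums are $0$). Admissible sets. A family $(K_w,a_w,\Upsilon_w)_{w\in W}$, where $W$ is any set, $K_w\subseteq[0,1]^n$ is compact, $a_w\in K_w$, and $\Upsilon_w:[0,\infty)^n\to\mathbb R^n$ is a map, is an admissible collection of degree $d\in\mathbb N_{\ge1}$ if there are constants $\delta_1,\delta_2,\delta_3>0$, $q\in\mathbb N_{\ge1}$ and polynomial maps $R_w:\mathbb R^n\to\mathbb R^n$ of degree at most $d$ such that for all $w\in W$: (1) $K_w$ is star-shaped with respect to $a_w$ and $|K_w|\ge\delta_1$; (2) $\Upsilon_w(x_1,\dots,x_n)=R_w(x_1^{1/q},\dots,x_n^{1/q})$; (3) $\delta_2\le\sum_\kappa|c_{w,\kappa}|\le\delta_3$, where $c_{w,\kappa}$ are the coefficients of the polynomial $\operatorname{Jac}(R_w)$ (the Jacobian determinant); (4) writing $a_w=(a_{w,1},\dots,a_{w,n})$, $a_{w,i}=0$ whenever $\Upsilon_w$ is not a polynomial map with respect to the variable $x_i$. A nonempty compact set $K\subseteq\mathbb R^n$ is admissible (of degree $d$) if there is an admissible collection (of degree $d$) $(K_w,a_w,\Upsilon_w)_{w\in K}$ indexed by $K$ with $\Upsilon_w(a_w)=w$ for each $w\in K$ and $K=\bigcup_{w\in K}\Upsilon_w(K_w)$. $\mathscr K(\mathbb R^n)$ is the family of all admissible sets. For each $K\in\mathscr K(\mathbb R^n)$ such a collection and its degree $d$ are fixed ($d=1$ if $K$ is a convex body), and $$a_K:=4\,\tfrac{(d+1)^{d+1}}{(d-1)^{d-1}}\max\{\operatorname{diam}(K),1\}\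 \text{ if }d\ge2,\qquad a_K:=\operatorname{diam}(K)\ \text{ if }d=1.$$ *)

(* Defs.v *)
From HB Require Import structures.
From mathcomp Require Import all_boot all_order all_algebra.
From mathcomp Require Import all_classical all_reals all_analysis.
From mathcomp.multinomials Require mpoly.
(* Importing all of mpoly would clash with notations of mathcomp-analysis. *)
Import (canonicals, coercions) mpoly.

Set Implicit Arguments.
Unset Strict Implicit.
Unset Printing Implicit Defensive.

Import Order.TTheory GRing.Theory Num.Theory.
Import numFieldNormedType.Exports.

Local Open Scope classical_set_scope.
Local Open Scope ring_scope.

Fact rV_display : measure_display.
Proof. exact: default_measure_display. Qed.

(* 'rV[R]_n carries the product sigma-algebra, generated by the coordinates. *)
Section rV_measurable.
Variables (R : realType) (n : nat).

Let coord (i : 'I_n) (x : 'rV[R]_n) : measurableTypeR R := x ord0 i.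

Let rV_set0 : g_sigma_preimage coord set0.
Proof. exact: sigma_algebra0. Qed.

Let rV_setC A : g_sigma_preimage coord A -> g_sigma_preimage coord (~` A).
Proof. exact: sigma_algebraC. Qed.

Let rV_bigcup (F : _^nat) : (forall i, g_sigma_preimage coord (F i)) ->
  g_sigma_preimage coord (\bigcup_i (F i)).
Proof. exact: sigma_algebra_bigcup. Qed.

HB.instance Definition _ := @isMeasurable.Build rV_display
  'rV[R]_n (g_sigma_preimage coord) rV_set0 rV_setC rV_bigcup.

Lemma measurable_rV_coord (i : 'I_n) :
  measurable_fun [set: 'rV[R]_n]
    (fun x : 'rV[R]_n => x ord0 i : measurableTypeR R).
Proof.
move=> _ Y mY; rewrite setTI; apply: sub_sigma_algebra => /=.
rewrite -bigcup_seq/=; exists i => /=; first by rewrite mem_index_enum.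
by exists Y => //; rewrite setTI.
Qed.

Lemma measurable_fun_rV d (T : measurableType d) (f : T -> 'rV[R]_n) :
  (forall i, measurable_fun [set: T]
     (fun t => f t ord0 i : measurableTypeR R)) ->
  measurable_fun [set: T] f.
Proof.
move=> mf; apply: (@measurability _ _ _ _ _ _
  (\big[setU/set0]_(i < n) preimage_set_system setT (coord i) measurable)) => //.
move=> _ [B + <-]; rewrite -bigcup_seq/= => -[i _ [A mA <-]].
by rewrite setTI; apply: mf.
Qed.

End rV_measurable.

Definition rV_cons (R : realType) n (p : measurableTypeR R * 'rV[R]_n) :
  'rV[R]_n.+1 := \row_i oapp (p.2 ord0) p.1 (unlift ord0 i).

Lemma measurable_rV_cons (R : realType) n :
  measurable_fun [set: measurableTypeR R * 'rV[R]_n] (@rV_cons R n).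
Proof.
apply: measurable_fun_rV => i.
under eq_fun do rewrite mxE.
case: (unliftP ord0 i) => [j|] _ /=; last exact: measurable_fst.
exact: measurableT_comp (measurable_rV_coord j) measurable_snd.
Qed.

(* n-dimensional Lebesgue measure: the product of n copies of the Lebesgue
   measure on R, transported to row vectors. *)
Fixpoint lebesgue_rV (R : realType) n : set 'rV[R]_n -> \bar R :=
  match n with
  | 0 => @dirac _ 'rV[R]_0 0 R
  | n'.+1 => pushforward (@lebesgue_measure R \x @lebesgue_rV R n')%E
               (@rV_cons R n')
  end.
Arguments lebesgue_rV R n : clear implicits.

Section lebesgue_rV_step.
Variables (R : realType) (n : nat).
Variable m : {sigma_finite_measure set 'rV[R]_n -> \bar R}.

Let step : set 'rV[R]_n.+1 -> \bar R :=
  pushforward (@lebesgue_measure R \x m)%E (@rV_cons R n).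

Let step0 : step set0 = 0%E.
Proof. by rewrite /step /pushforward preimage_set0 measure0. Qed.

Let step_ge0 A : (0 <= step A)%E.
Proof. by rewrite /step /pushforward measure_ge0. Qed.

Let step_sigma_additive : semi_sigma_additive step.
Proof.
move=> F mF tF mUF; rewrite /step /pushforward preimage_bigcup.
have mcons A : measurable A -> measurable (@rV_cons R n @^-1` A).
  by move=> mA; rewrite -[X in measurable X]setTI; exact: measurable_rV_cons.
apply: measure_semi_sigma_additive.
- by move=> k; exact: mcons.
- apply/trivIsetP => /= i j _ _ ij; rewrite -preimage_setI.
  by move/trivIsetP : tF => /(_ _ _ _ _ ij) ->//; rewrite preimage_set0.
- by rewrite -preimage_bigcup; exact: mcons.
Qed.

HB.instance Definition _ := isMeasure.Build _ _ _ step
  step0 step_ge0 step_sigma_additive.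

Let step_sigma_finite : sigma_finite setT step.
Proof.
have /sigma_finiteP[F [FT ndF Foo]] := sigma_finiteT (@lebesgue_measure R).
have /sigma_finiteP[G [GT ndG Goo]] := sigma_finiteT m.
pose g (x : 'rV[R]_n.+1) : measurableTypeR R * 'rV[R]_n :=
  (x ord0 ord0, \row_i x ord0 (lift ord0 i)).
have consK : cancel (@rV_cons R n) g.
  move=> [t y]; rewrite /g /rV_cons /= mxE unlift_none/=; congr pair.
  by apply/rowP => i; rewrite !mxE liftK.
have mg : measurable_fun setT g.
  apply/measurable_fun_pairP; split => /=.
    exact: measurable_rV_coord.
  apply: measurable_fun_rV => i.
  by under eq_fun do rewrite /= mxE; exact: measurable_rV_coord.
exists (fun k => g @^-1` (F k `*` G k)).
  rewrite -preimage_bigcup; apply/seteqP; split=> // x _ /=.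
  have [i _ Fi] : (\bigcup_k F k) (g x).1 by rewrite -FT.
  have [j _ Gj] : (\bigcup_k G k) (g x).2 by rewrite -GT.
  exists (maxn i j) => //; split.
    by move: (g x).1 Fi; exact/subsetPset/ndF/leq_maxl.
  by move: (g x).2 Gj; exact/subsetPset/ndG/leq_maxr.
move=> k; have [mF Fk] := Foo k; have [mG Gk] := Goo k; split.
  by rewrite -[X in measurable X]setTI; apply: mg => //; exact: measurableX.
rewrite /step /pushforward -comp_preimage (_ : g \o _ = id); last first.
  by apply/funext => p /=; rewrite consK.
by rewrite /= product_measure1E// lte_mul_pinfty// ge0_fin_numE.
Qed.

HB.instance Definition _ := Measure_isSigmaFinite.Build _ _ _ step
  step_sigma_finite.

Lemma lebesgue_rV_step :
  exists m' : {sigma_finite_measure set 'rV[R]_n.+1 -> \bar R},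
    pushforward (@lebesgue_measure R \x m)%E (@rV_cons R n) = m'.
Proof. by exists step. Qed.

End lebesgue_rV_step.

Section lebesgue_rV_measure.
Variables (R : realType) (n : nat).

Let lebesgue_rV_ex k :
  exists m : {sigma_finite_measure set 'rV[R]_k -> \bar R},
    lebesgue_rV R k = m.
Proof.
elim: k => [|k [m mE]]; first by exists (@dirac _ 'rV[R]_0 0 R).
by rewrite /= mE; exact: lebesgue_rV_step.
Qed.

Let lebesgue_rV0 : lebesgue_rV R n set0 = 0%E.
Proof. by have [m ->] := lebesgue_rV_ex n; exact: measure0. Qed.

Let lebesgue_rV_ge0 A : (0 <= lebesgue_rV R n A)%E.
Proof. by have [m ->] := lebesgue_rV_ex n; exact: measure_ge0. Qed.

Let lebesgue_rV_sigma_additive : semi_sigma_additive (lebesgue_rV R n).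
Proof.
by have [m ->] := lebesgue_rV_ex n; exact: measure_semi_sigma_additive.
Qed.

HB.instance Definition _ := isMeasure.Build _ _ _ (lebesgue_rV R n)
  lebesgue_rV0 lebesgue_rV_ge0 lebesgue_rV_sigma_additive.

Let lebesgue_rV_sigma_finite : sigma_finite setT (lebesgue_rV R n).
Proof. by have [m ->] := lebesgue_rV_ex n; exact: sigma_finiteT. Qed.

HB.instance Definition _ := Measure_isSigmaFinite.Build _ _ _
  (lebesgue_rV R n) lebesgue_rV_sigma_finite.

End lebesgue_rV_measure.

Lemma measurable_rV_box (R : realType) n (A : 'I_n -> set (measurableTypeR R)) :
  (forall i, measurable (A i)) ->
  measurable [set x : 'rV[R]_n | forall i, A i (x ord0 i)].
Proof.
move=> mA; rewrite [X in measurable X](_ : _ = \big[setI/setT]_(i < n)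
    ((fun x : 'rV[R]_n => x ord0 i : measurableTypeR R) @^-1` A i)).
  apply: bigsetI_measurable => i _; rewrite -[X in measurable X]setTI.
  exact: measurable_rV_coord.
rewrite -bigcap_seq; apply/seteqP; split=> x /=.
  by move=> Ax i _; exact: Ax.
by move=> Ax i; apply: Ax => /=; rewrite mem_index_enum.
Qed.

Lemma lebesgue_rV_box (R : realType) n (A : 'I_n -> set (measurableTypeR R)) :
  (forall i, measurable (A i)) ->
  lebesgue_rV R n [set x | forall i, A i (x ord0 i)] =
  (\prod_(i < n) lebesgue_measure (A i))%E.
Proof.
elim: n A => [|n IHn] A mA.
  by rewrite big_ord0 /= diracE mem_set// => -[].
rewrite big_ord_recl -IHn//.
rewrite -(product_measure1E lebesgue_measure (lebesgue_rV R n) (mA ord0)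
  (measurable_rV_box (fun i => mA (lift ord0 i)))).
apply: (f_equal (lebesgue_measure \x lebesgue_rV R n)%E).
apply/seteqP; split=> -[t y] /=.
  move=> Aty; split=> [|i].
    by have := Aty ord0; rewrite mxE unlift_none.
  by have := Aty (lift ord0 i); rewrite mxE liftK.
by move=> [At Ay] i; rewrite mxE; case: unliftP => [j|] ->/=.
Qed.

Section geometry.
Variables (R : realType) (n : nat).
Implicit Types (K L : set 'rV[R]_n) (a x y : 'rV[R]_n).

(* The library norm on 'rV[R]_n is the sup norm; diameters are Euclidean. *)
Definition enorm x : R := Num.sqrt (\sum_(i < n) x ord0 i ^+ 2).

Definition diam K : R := sup [set enorm (x - y) | x in K & y in K].

Definition convex_body K : Prop :=
  [/\ compact K, @convex_set R 'rV[R]_n K & K° !=set0].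

Definition star_shaped K a : Prop :=
  K a /\ forall x (t : R), K x -> 0 <= t <= 1 -> K (a + t *: (x - a)).

Definition unit_cube : set 'rV[R]_n := [set x | forall i, 0 <= x ord0 i <= 1].

Definition orthant : set 'rV[R]_n := [set x | forall i, 0 <= x ord0 i].

End geometry.

Section smoothness.
Variables (R : realType) (n : nat).
Implicit Types (U L E : set 'rV[R]_n) (f : 'rV[R]_n -> R) (mu : nat -> R).

Definition partial (i : 'I_n) f : 'rV[R]_n -> R :=
  fun x => 'D_(delta_mx ord0 i) f x.

Definition partialn (al : 'I_n -> nat) f : 'rV[R]_n -> R :=
  foldr (fun i => iter (al i) (partial i)) f (enum 'I_n).

Fixpoint class_C (k : nat) U f : Prop :=
  (forall x, U x -> {for x, continuous f}) /\
  match k with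
  | 0 => True
  | k'.+1 => forall i : 'I_n,
      (forall x, U x -> derivable f x (delta_mx ord0 i)) /\
      class_C k' U (partial i f)
  end.

(* Weights are indexed from 1; the value [mu 0] is never used. *)
Definition admissible_weight mu : Prop :=
  0 < mu 1%N /\ forall j, (1 <= j)%N -> mu j <= mu j.+1.

Definition weight_seq mu (M0 : R) (j : nat) : R :=
  M0 * \prod_(1 <= i < j.+1) mu i.

(* Orders of smoothness range over nat extended with None for infinity;
   [le_order j N] is j < N + 1. *)
Definition le_order (j : nat) (N : option nat) : bool :=
  if N is Some k then (j <= k)%N else true.

(* A function on L is given by a function on the whole space; only its values
   on some neighborhood of L are constrained. *)
Definition smooth mu (N : option nat) (M0 : R) L f : Prop :=
  (exists U, [/\ open U, L `<=` U &
     forall k, le_order k N -> class_C k U f]) /\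
  forall j, le_order j N ->
    (ereal_sup [set (\sum_(al : {ffun 'I_n -> 'I_j.+1} |
                          (\sum_i (al i : nat) == j)%N)
                       j`!%:R / (\prod_i (al i)`!)%N%:R *
                       `|partialn (fun i => al i) f x|)%:E | x in L]
     <= (weight_seq mu M0 j)%:E)%E.

Definition supnorm E f : \bar R := ereal_sup [set `|f x|%:E | x in E].

End smoothness.

Section degree.
Variable R : realType.
Implicit Types (mu : nat -> R) (A a b : R).

Definition index0 A b : nat :=
  infimum 0%N [set j : nat | ln (A / b) <= j%:R].

Definition admissible_tuple mu A a b : Prop :=
  [/\ 0 < A, 0 < a, 0 < b &
    ((a * expR 1)%:E <
      \sum_((index0 A b).+1 <= j <oo) ((mu j)^-1)%:E)%E].

Definition degreeN mu A a b : nat :=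
  (2 * supremum 0%N
         [set k : nat | (\sum_((index0 A b).+1 <= j < k.+1) (a * mu j)^-1
                         < expR 1)%R])%N.

End degree.

Section admissible_sets.
Variables (R : realType) (n : nat).

Local Notation mpoly := (mpoly.mpoly n R).
Local Notation rV := 'rV[R]_n.

Definition jac_det (P : 'I_n -> mpoly) : mpoly :=
  \det (\matrix_(i < n, j < n) mpoly.mderiv j (P i)).

Definition coef_norm (p : mpoly) : R :=
  \sum_(m <- mpoly.msupp p) `|mpoly.mcoeff m p|.

Definition eval_map (P : 'I_n -> mpoly) (x : rV) : rV :=
  \row_i mpoly.meval (fun j => x ord0 j) (P i).

Definition set_coord (x : rV) (i : 'I_n) (t : R) : rV :=
  \row_j (if j == i then t else x ord0 j).

Definition polynomial_in (Ups : rV -> rV) (i : 'I_n) : Prop :=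
  forall x, orthant x -> forall k : 'I_n, exists p : {poly R},
    forall t, 0 <= t -> Ups (set_coord x i t) ord0 k = p.[t].

(* The maps [Ups w] only matter on the nonnegative orthant. *)
Definition admissible_collection (d : nat) (T : Type) (W : set T)
    (Kw : T -> set rV) (aw : T -> rV) (Ups : T -> rV -> rV) : Prop :=
  [/\ (1 <= d)%N,
      forall w, W w ->
        [/\ Kw w `<=` @unit_cube R n, compact (Kw w) & Kw w (aw w)] &
  exists delta1 delta2 delta3 : R, exists q : nat,
  exists P : T -> 'I_n -> mpoly,
    [/\ 0 < delta1, 0 < delta2, 0 < delta3, (1 <= q)%N &
    forall w, W w ->
      [/\ forall i, (mpoly.msize (P w i) <= d.+1)%N,
          star_shaped (Kw w) (aw w) /\
            (delta1%:E <= lebesgue_rV R n (Kw w))%E,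
          forall x, orthant x ->
            Ups w x = eval_map (P w) (\row_i (x ord0 i `^ q%:R^-1)),
          delta2 <= coef_norm (jac_det (P w)) <= delta3 &
          forall i, ~ polynomial_in (Ups w) i -> aw w ord0 i = 0]]].

Definition admissible_set (d : nat) (K : set rV) : Prop :=
  [/\ K !=set0, compact K &
  exists (Kw : rV -> set rV) (aw : rV -> rV) (Ups : rV -> rV -> rV),
    [/\ admissible_collection d K Kw aw Ups,
        forall w, K w -> Ups w (aw w) = w &
        K = \bigcup_(w in K) (Ups w @` Kw w)]].

Definition a_const (d : nat) (K : set rV) : R :=
  if (2 <= d)%N then
    4 * (d.+1%:R ^+ d.+1 / d.-1%:R ^+ d.-1) * Num.max (diam K) 1
  else diam K.

End admissible_sets.

(* |f|^(-alpha), with value +oo on the zero set of f (recall 0 `^ (- alpha) = 0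
   in the library when alpha != 0). *)
Definition inv_power (R : realType) (T : Type) (f : T -> R) (alpha : R) (x : T)
  : \bar R :=
  if f x == 0 then +oo%E else (`|f x| `^ (- alpha))%:E.

(* Main.v *)
(** Bang's argument shows that a function on an interval whose derivatives of
    order at most [m + 1] satisfy the prescribed bounds and vanish at one
    endpoint up to order [m], where [N = 2 m], is smaller than [b0] at the other
    endpoint. Fix [w0] in [K] with [`|f w0| >= b0]. For every [w] in [K] the
    segment from [w] to [w0] lies in the convex body [L] and has length at most
    [diam K <= a_K], so some derivative of [f] at [w] in the direction [w0 - w],
    of order [k <= m], does not vanish. Near [w] this derivative stays bounded
    away from [0], also for a slightly perturbed direction, and along lines of
    that direction Rolle's theorem bounds [|f|] from below by a multiple of the
    [k]-th power of the distance to a set of boundedly many points. Hence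
    [|f| ^ - alpha] has uniformly bounded integrals along these lines as soon as
    [alpha k < 1], and Fubini's theorem after a shear together with the
    compactness of [K] concludes. *)
Require Import Defs.
From mathcomp Require Import all_boot all_order all_algebra.
From mathcomp Require Import all_classical all_reals all_analysis.
From mathcomp Require Import measurable_realfun ring lra.
Set Implicit Arguments.
Unset Strict Implicit.
Unset Printing Implicit Defensive.
Import Order.TTheory GRing.Theory Num.Theory.
Import numFieldNormedType.Exports.
Local Open Scope classical_set_scope.
Local Open Scope ring_scope.

(** * Bang's theorem and lower bounds in one variable *)

Section one_variable.
Variable R : realType.

(** The hypothesis bounds mixed partials weighted by multinomial coefficients, while Bang's argument
    wants one chain of successive derivatives. Symmetry of mixed partials is the bridge: when the
    [j]-th derivative in direction [v] is expanded over words of length [j], exactly [j! / al!]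
    words yield the multi-index [al], so a direction with coordinates at most [a] gives the bound
    [a ^ j * M_j]. Parametrizing the segment by the unit interval therefore turns [mu j] into
    [a * mu j], the quantity in the definition of the degree. The number [j0] enters through
    [M0 * e ^ - j0 <= b0]. Since [b0 < M0] it is positive, so [m >= 1] and [m + 1 <= 2 m]: the
    derivatives of order [m + 1], needed to close Bang's induction, are covered by smoothness of
    order [N]. The direction [w0 - w] may have first coordinate [0], and is zero for [w = w0]; it is
    perturbed and rescaled to have first coordinate [1], which makes the straightening map a shear.
    The one-variable estimates must hold with one constant for all parallel lines, so their
    constants depend on the order, a lower bound and a length, never on the function. *)

Lemma le_increment (u du v dv : R -> R) (a b : R) : a <= b ->
  (forall x, a <= x <= b -> is_derive x 1 u (du x)) ->
  (forall x, a <= x <= b -> is_derive x 1 v (dv x)) ->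
  (forall x, a <= x <= b -> du x <= dv x) -> u b - u a <= v b - v a.
Proof.
move=> ab hu hv le_uv.
have hw x : a <= x <= b -> is_derive x 1 (v - u) (dv x - du x).
  by move=> xab; have := hu _ xab; have := hv _ xab; move=> ? ?; exact: is_deriveB.
have [c cab] : exists2 c, c \in `[a, b] &
    (v - u) b - (v - u) a = (dv c - du c) * (b - a).
  apply: MVT_segment => // [x|].
    by rewrite in_itv/= => /andP[ax xb]; apply: hw; rewrite !ltW.
  by apply: derivable_within_continuous => x; rewrite in_itv/= => /hw[].
rewrite in_itv/= in cab.
rewrite !fctE => E; rewrite -subr_ge0.
have -> : v b - v a - (u b - u a) = (dv c - du c) * (b - a) by rewrite -E; ring.
by rewrite mulr_ge0// subr_ge0// le_uv.
Qed.

(** The reverse triangle inequality replaces a derivative of [|u|], which may fail to exist at zeros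
    of [u]. *)
Lemma le_norm_increment (u du v dv : R -> R) (a b : R) : a <= b ->
  (forall x, a <= x <= b -> is_derive x 1 u (du x)) ->
  (forall x, a <= x <= b -> is_derive x 1 v (dv x)) ->
  (forall x, a <= x <= b -> `|du x| <= dv x) ->
  `|u b| - `|u a| <= v b - v a.
Proof.
move=> ab hu hv le_uv.
apply: (le_trans (lerB_dist _ _)); rewrite ler_norml lerNl opprB; apply/andP; split.
  have := @le_increment (- u) (- du) v dv a b ab.
  rewrite !fctE opprK addrC; apply => //.
    by move=> x /hu ?; exact: is_deriveN.
  by move=> x /le_uv /ler_normlP[].
by apply: (@le_increment u du v dv a b ab) => // x /le_uv /ler_normlP[].
Qed.

Lemma is_derive_expR_affine (c e s x : R) :
  is_derive x 1 (fun y => c * expR (e * (y - s))) (e * (c * expR (e * (x - s)))).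
Proof.
have h : is_derive x 1 (fun y : R => e * (y - s)) e.
  apply: is_derive_eq.
  by rewrite subr0 /GRing.scale/= mulr1.
have := @is_derive1_comp _ expR _ x _ _ (is_derive_expR _) h.
move=> h2; have := is_deriveZ c h2.
rewrite /GRing.scale/= => h3.
apply: (is_derive_eq h3); rewrite /GRing.scale/=; ring.
Qed.

(* Bang's argument: the weighted norms [|G j t| / (e ^ j M_j)] of the first [k]
   derivatives need time at least [1 / (e m_k)] to grow from [e ^ - k] to
   [e ^ - (k - 1)]. *)
Lemma bang (G : nat -> R -> R) (M m : nat -> R) (N j0 : nat) :
  (forall j, 0 < M j) -> (forall j, M j.+1 = M j * m j.+1) ->
  (forall j, 0 < m j.+1) -> (forall i j, (i <= j)%N -> m i.+1 <= m j.+1) ->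
  (forall j (t : R), (j < N)%N -> 0 <= t <= 1 -> is_derive t 1 (G j) (G j.+1 t)) ->
  (forall j (t : R), (j <= N)%N -> 0 <= t <= 1 -> `|G j t| <= M j) ->
  (forall j, (j < N)%N -> G j 0 = 0) ->
  (0 < j0 <= N)%N -> expR 1 <= \sum_(j0.+1 <= j < N.+1) (m j)^-1 ->
  `|G 0%N 1| < M 0%N * expR (- j0%:R).
Proof.
move=> M0 MS m0 mono dG bG G0 /andP[j00 j0N] sume.
(* Up to time [S k] all weighted norms of order below [k] stay under [e ^ - k]; this time is [0] for
   [k = N] and at least [1] for [k = j0]. *)
pose S k : R := \sum_(k.+1 <= j < N.+1) (expR 1 * m j)^-1.
have S0 k : 0 <= S k.
  rewrite /S big_nat_cond sumr_ge0// => -[//|j] _; rewrite invr_ge0 mulr_ge0 ?expR_ge0//.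
  exact: ltW.
suff claim i k (t : R) : (i + k = N)%N -> 0 <= t <= 1 -> t <= S k ->
    forall j, (j < k)%N -> `|G j t| < M j * expR (j%:R - k%:R).
  have := claim (N - j0)%N j0 1; rewrite subnK// lexx ler01 => /(_ erefl isT).
  rewrite -[X in expR X]sub0r => claim1; apply: claim1 => //.
  rewrite /S; under eq_bigr do rewrite invfM.
  by rewrite -mulr_sumr mulrC ler_pdivlMr ?expR_gt0// mul1r.
elim: i k t => [|i IH] k t.
  rewrite add0n => -> t01; rewrite /S big_geq// => t0 j jk.
  have -> : t = 0 by apply/eqP; rewrite eq_le t0; case/andP: t01.
  by rewrite G0// normr0 mulr_gt0// expR_gt0.
rewrite addSnnS => ikN /andP[t0 t1] tS.
have kN : (k < N)%N by rewrite -ikN leq_addl.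
pose e := expR 1 * m k.+1.
have e0 : 0 < e by rewrite mulr_gt0// expR_gt0.
(* [s] is a time already covered by level [k + 1] and at most [e^-1] before [t]; here [e] is the
   rate [expR 1 * m k.+1], not Euler's number. *)
have [s [s0 st sS ts]] : exists s, [/\ 0 <= s, s <= t, s <= S k.+1 & t - s <= e^-1].
  have SE : S k = e^-1 + S k.+1 by rewrite /S big_ltn.
  have [tS'|S't] := leP t (S k.+1).
    by exists t; split=> //; rewrite subrr invr_ge0 ltW.
  by exists (S k.+1); split; rewrite ?lexx ?S0 ?(ltW S't)// lerBlDr -SE.
have s01 : 0 <= s <= 1 by rewrite s0 (le_trans st).
have IHs := IH _ _ ikN s01 sS.
(* [phi j s] is the bound known at time [s]. For [j <= k] the monotonicity of [m] makes [phi j.+1]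
   at most the derivative of [phi j], and up to time [t] each majorant grows by at most a factor
   [expR 1], which is the loss of one level. *)
pose phi j (x : R) := M j * expR (j%:R - k.+1%:R) * expR (e * (x - s)).
have dphi j (x : R) : is_derive x 1 (phi j) (e * phi j x).
  exact: is_derive_expR_affine.
have phi0 j (x : R) : 0 < phi j x by rewrite !mulr_gt0// expR_gt0.
have phiS j (x : R) : (j <= k)%N -> phi j.+1 x <= e * phi j x.
  move=> jk; rewrite /phi /e MS -(natr1 j) -addrA (addrC 1) addrA expRD.
  rewrite [X in _ <= X](_ : _ = M j * m k.+1 * (expR (j%:R - k.+1%:R) * expR 1) *
     expR (expR 1 * m k.+1 * (x - s))); last by ring.
  by rewrite !ler_wpM2r ?expR_ge0 ?mulr_ge0 ?expR_ge0// ler_wpM2l ?mono// ltW.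
have inc j (x : R) : (j <= k)%N -> s <= x <= t -> (forall y, s <= y <= x ->
    `|G j.+1 y| <= phi j.+1 y) -> `|G j x| < phi j x.
  move=> jk /andP[sx xt] h.
  have y01 (y : R) : s <= y <= x -> 0 <= y <= 1.
    move=> /andP[sy yx]; rewrite (le_trans s0 sy)/=.
    by rewrite (le_trans yx)// (le_trans xt).
  have := @le_norm_increment (G j) (G j.+1) (phi j) (fun x => e * phi j x) s x sx.
  move=> /(_ _ _ _); have Gs : `|G j s| < phi j s.
    by rewrite /phi subrr mulr0 expR0 mulr1; apply: IHs.
  suff H : `|G j x| - `|G j s| <= phi j x - phi j s -> `|G j x| < phi j x.
    move=> H2; apply: H; apply: H2 => // y sy.
    + by apply: dG => //; [exact: leq_ltn_trans kN|exact: y01].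
    + by apply: le_trans (h _ sy) _; exact: phiS.
  lra.
(* Downward induction on [j = k + 1 - l]: at order [k + 1] the majorant is at least [M k.+1], so the
   a priori bound starts the induction. *)
have all_j l j (x : R) : (j + l = k.+1)%N -> s <= x <= t -> `|G j x| <= phi j x.
  elim: l j x => [|l IHl] j x.
    rewrite addn0 => -> /andP[sx xt]; apply: (@le_trans _ _ (M k.+1)).
      by apply: bG => //; rewrite (le_trans s0 sx) (le_trans xt).
    by rewrite /phi subrr expR0 mulr1 ler_peMr ?(ltW (M0 _))// -expR0 ler_expR mulr_ge0
      ?(ltW e0)// subr_ge0.
  move=> jl sx; apply/ltW/inc => //.
    by move: jl; rewrite addnS => -[<-]; rewrite leq_addr.
  move=> y /andP[sy yx]; apply: IHl; first by rewrite addSnnS.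
  by rewrite sy (le_trans yx)//; case/andP: sx.
move=> j jk; apply: (@lt_le_trans _ _ (phi j t)).
  apply: inc; [exact: ltnW|by rewrite st lexx|].
  move=> y /andP[sy yt]; apply: (all_j (k - j)%N); last by rewrite sy yt.
  by rewrite addSn subnKC// ltnW.
rewrite /phi -mulrA -expRD ler_wpM2l ?(ltW (M0 _))// ler_expR.
have : e * (t - s) <= 1.
  by rewrite -(divff (lt0r_neq0 e0)) ler_wpM2l// ltW.
by rewrite -(natr1 k); lra.
Qed.

End one_variable.

(** * Rolle's theorem, number of zeros, and lower bounds away from them *)

Section zeros.
Variable R : realType.

Lemma interior_increment (u du : R -> R) (a b p q : R) : p < a -> a < b -> b < q ->
  (forall x, p < x < q -> is_derive x 1 u (du x)) ->
  exists2 c, a < c < b & u b - u a = du c * (b - a).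
Proof.
move=> pa ab bq hu.
have [c cab E] : exists2 c, c \in `]a, b[ & u b - u a = du c * (b - a).
  apply: MVT => // [x|].
    by rewrite in_itv/= => /andP[ax xb]; apply: hu; rewrite (lt_trans pa)// (lt_trans xb).
  apply: derivable_within_continuous => x; rewrite in_itv/= => /andP[ax xb].
  by have [] := hu x _; rewrite ?(lt_le_trans pa)// (le_lt_trans xb).
by exists c => //; rewrite in_itv/= in cab.
Qed.

(** The first zero [x] is kept apart from the list: each gap of [x :: s] contributes one zero of
    [du], so the sizes of [s] and [s'] agree. *)
Lemma Rolle_seq (u du : R -> R) (p q : R) :
  (forall x, p < x < q -> is_derive x 1 u (du x)) ->
  forall (s : seq R) (x : R), p < x -> u x = 0 ->
    path <%R x s -> {in s, forall y, y < q /\ u y = 0} ->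
  exists s', [/\ size s' = size s, path <%R x s' &
    {in s', forall y, y < q /\ du y = 0}].
Proof.
move=> hu; elim=> [|y s IH] x px ux /=; first by exists [::].
move=> /andP[xy ys] us.
have [yq uy] := us y (mem_head _ _).
have [|s' [ss ps s0]] := IH y (lt_trans px xy) uy ys.
  by move=> z zs; apply: us; rewrite inE zs orbT.
have [c /andP[xc cy] /eqP] := interior_increment px xy yq hu.
rewrite uy ux subrr eq_sym mulf_eq0 (gt_eqF (_ : 0 < y - x)) ?subr_gt0// orbF => /eqP c0.
exists (c :: s'); split=> /=; first by rewrite ss.
  by rewrite xc; case: s' ps {ss s0} => //= z s' /andP[yz ->]; rewrite (lt_trans cy).
by move=> z; rewrite inE => /orP[/eqP->|/s0//]; split=> //; exact: lt_trans yq.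
Qed.

(** [du] is not assumed continuous, so its sign on the interval is not immediate. If
    [0 < u x < b * h], the mean value theorem puts [u] above [u x] at both ends, since a change by
    [b * h] the other way would make [u] negative there. Then [u] has an interior minimum, where
    [du] would vanish. *)
Lemma ge_away_zero (u du : R -> R) (x h b : R) : 0 < h -> 0 < b ->
  (forall y, `|y - x| <= h -> [/\ is_derive y 1 u (du y), u y != 0 & b <= `|du y|]) ->
  b * h <= `|u x|.
Proof.
wlog ux : u du / 0 < u x.
  move=> W h0 b0 hu; have [ux|ux|ux] := ltgtP (u x) 0; last first.
  - have [|_ /eqP//] := hu x; first by rewrite subrr normr0 ltW.
  - exact: W hu.
  - rewrite -normrN; apply: (W (- u) (- du)); rewrite ?fctE ?oppr_gt0//.
    by move=> y /hu[? ? ?]; split; rewrite ?fctE ?oppr_eq0 ?normrN//; exact: is_deriveN.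
move=> h0 b0 hu; rewrite gtr0_norm// leNgt; apply/negP => uxbh.
have xh y : x - h <= y <= x + h -> `|y - x| <= h.
  by move=> /andP[? ?]; rewrite ler_norml; apply/andP; split; lra.
have dux y : x - h <= y <= x + h -> is_derive y 1 u (du y).
  by move=> /xh/hu[].
have cu a c : x - h <= a -> c <= x + h -> {within `[a, c], continuous u}.
  move=> xa cx; apply: derivable_within_continuous => y; rewrite in_itv/= => /andP[ay yc].
  by have [] := dux y; rewrite ?(le_trans xa)// (le_trans yc).
have pos y : x - h <= y <= x + h -> 0 < u y.
  move=> yx; rewrite ltNge; apply/negP => uy.
  suff [c cxy uc] : exists2 c, `|c - x| <= h & u c = 0 by have [_ /eqP] := hu c cxy.
  move: yx => /andP[y1 y2].
  have [yx|xy] := leP y x.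
    have [||c] := @IVT _ u y x 0 yx; first by apply: cu; lra.
      by rewrite ge_min uy le_max (ltW ux) orbT.
    by rewrite in_itv/= => /andP[? ?] uc; exists c => //; apply: xh; lra.
  have [||c] := @IVT _ u x y 0 (ltW xy); first by apply: cu; lra.
    by rewrite ge_min uy orbT le_max (ltW ux).
  by rewrite in_itv/= => /andP[? ?] uc; exists c => //; apply: xh; lra.
have mvt a c : x - h <= a -> a < c -> c <= x + h ->
    exists2 e, x - h <= e <= x + h & u c - u a = du e * (c - a).
  move=> xa ac cx.
  have [e|e eac E] := @MVT _ u du a c ac _ (cu _ _ xa cx).
    by rewrite in_itv/= => /andP[? ?]; apply: dux; lra.
  by exists e => //; move: eac; rewrite in_itv/= => /andP[? ?]; lra.
have xmh : u x < u (x - h).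
  have [|||e ex] := mvt (x - h) x; [lra|lra|lra|].
  have [_ _] := hu e (xh _ ex).
  rewrite (_ : x - (x - h) = h); last by ring.
  have := pos (x - h); rewrite ler_normr => pp /orP[bd|bd] E; last first.
    by have := ler_wpM2r (ltW h0) bd; have := mulr_gt0 b0 h0; lra.
  have := ler_wpM2r (ltW h0) bd; rewrite -E; have : 0 < u (x - h) by apply: pp; lra.
  lra.
have xph : u x < u (x + h).
  have [|||e ex] := mvt x (x + h); [lra|lra|lra|].
  have [_ _] := hu e (xh _ ex).
  rewrite (_ : x + h - x = h); last by ring.
  have := pos (x + h); rewrite ler_normr => pp /orP[bd|bd] E.
    by have := ler_wpM2r (ltW h0) bd; have := mulr_gt0 b0 h0; lra.
  have := ler_wpM2r (ltW h0) bd; rewrite mulNr -E; have : 0 < u (x + h) by apply: pp; lra.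
  lra.
have [||c cx minc] := @EVT_min _ u (x - h) (x + h); [lra|exact: cu|].
have xx : x \in `[x - h, x + h] by rewrite in_itv/=; lra.
have cx' : x - h < c < x + h.
  move: cx; rewrite in_itv/= => /andP[c1 c2]; have := minc _ xx.
  rewrite !lt_neqAle c1 c2 !andbT => ucx; apply/andP; split; apply/eqP => E.
    by move: ucx; rewrite -E; lra.
  by move: ucx; rewrite E; lra.
have D0 : is_derive c 1 u 0.
  apply: (@derive1_at_min _ u (x - h) (x + h)) => //; first lra.
  - by move=> y; rewrite in_itv/= => /andP[? ?]; have [|] // := dux y; lra.
  - by move=> y; rewrite in_itv/= => /andP[? ?]; apply: minc; rewrite in_itv/= !ltW.
have [|D1 _] := hu c; first by apply: xh; lra.
have -> : du c = 0 by rewrite -(@derive_val _ _ _ _ _ _ _ D1) (@derive_val _ _ _ _ _ _ _ D0).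
by rewrite normr0; lra.
Qed.

(** Induction on [k]: each use of Rolle's theorem gives up one zero and one order of
    differentiation. *)
Lemma zeros_bound (k : nat) (G : nat -> R -> R) (p q : R) (s : seq R) :
  (forall j x, (j < k)%N -> p < x < q -> is_derive x 1 (G j) (G j.+1 x)) ->
  (forall x, p < x < q -> G k x != 0) ->
  sorted <%R s -> {in s, forall x, p < x < q /\ G 0%N x = 0} -> (size s <= k)%N.
Proof.
elim: k G s => [|k IH] G s dG Gk.
  by case: s => // x s _ /(_ _ (mem_head _ _))[/Gk/eqP].
case: s => // x s /= xs xs0.
have [/andP[px xq] Gx] := xs0 x (mem_head _ _).
have [] := @Rolle_seq (G 0%N) (G 1%N) p q _ s x px Gx xs.
- by move=> y; exact: dG.
- move=> y ys; have [|/andP[_ yq] Gy] := xs0 y; first by rewrite inE ys orbT.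
  by [].
move=> s' [ss xs' s0]; rewrite ltnS -ss; apply: (IH (fun j => G j.+1)) => //.
- by move=> j y jk; exact: dG.
- exact: path_sorted xs'.
move=> y ys; have [yq y0] := s0 y ys; split=> //; rewrite yq andbT (lt_trans px)//.
by move: xs'; rewrite (path_sortedE lt_trans) => /andP[/allP/(_ _ ys)].
Qed.

(** [zeros_bound] caps the length of sorted lists of zeros; a longest one contains every zero, as a
    missing one could be inserted. *)
Lemma zeros_seq (k : nat) (G : nat -> R -> R) (p q : R) :
  (forall j x, (j < k)%N -> p < x < q -> is_derive x 1 (G j) (G j.+1 x)) ->
  (forall x, p < x < q -> G k x != 0) ->
  exists2 s : seq R, (size s <= k)%N &
    forall x, p < x < q -> G 0%N x = 0 -> x \in s.
Proof.
move=> dG Gk.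
pose P n := `[< exists s : seq R, [/\ size s = n, sorted <%R s &
   {in s, forall x, p < x < q /\ G 0%N x = 0}] >].
have P0 : exists n, P n by exists 0%N; apply/asboolP; exists [::].
have Pk n : P n -> (n <= k)%N.
  by move=> /asboolP[s [<- ss s0]]; exact: zeros_bound dG Gk ss s0.
case: (ex_maxnP P0 Pk) => n /asboolP[s [sn ss s0]] nmax.
exists s; first by apply: zeros_bound dG Gk ss s0.
move=> x xpq Gx; apply/negPn/negP => xs.
have : P n.+1.
  apply/asboolP; exists (sort <=%R (x :: s)); split.
  - by rewrite size_sort/= sn.
  - by rewrite sort_lt_sorted/= xs lt_sorted_uniq.
  - by move=> y; rewrite mem_sort inE => /orP[/eqP->|/s0].
by move/nmax; rewrite ltnn.
Qed.

(* The points of [Z] are [p], [q] and the zeros of [G 0], ..., [G (k - 1)]. Away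
   from them [|G j|] is monotone, so it dominates the integral of [|G (j + 1)|]
   over half of the distance to [Z]. *)
Lemma ge_dist_exceptional (k : nat) : exists C : R, 0 < C /\ exists N : nat,
  forall (G : nat -> R -> R) (p q c : R), 0 < c ->
  (forall j x, (j < k)%N -> p < x < q -> is_derive x 1 (G j) (G j.+1 x)) ->
  (forall x, p < x < q -> c <= `|G k x|) ->
  exists Z : seq R, [/\ (size Z <= N)%N, p \in Z, q \in Z &
    forall x r : R, p < x < q -> 0 <= r -> {in Z, forall z, r <= `|x - z|} ->
      C * c * r ^+ k <= `|G 0%N x|].
Proof.
elim: k => [|k [C [C0 [N IH]]]].
  exists 1; split=> //; exists 2%N => G p q c c0 _ cG; exists [:: p; q]; split=> //.
  - exact: mem_head.
  - by rewrite !inE eqxx orbT.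
  - by move=> x r /cG; rewrite mul1r expr0 mulr1.
(* The bound [C * c * (r / 2) ^+ k] for [G 1] around [x], times the radius [r / 2], produces
   [2 ^- k.+1]; the [k.+1] points added to the count are the possible zeros of [G 0]. *)
exists (C * 2 ^- k.+1); split; first by rewrite mulr_gt0// invr_gt0 exprn_gt0.
exists (N + k.+1)%N => G p q c c0 dG cG.
have [||Z [ZN pZ qZ ZG]] := IH (fun j => G j.+1) p q c c0.
- by move=> j x jk; exact: dG.
- exact: cG.
have Gk0 x : p < x < q -> G k.+1 x != 0.
  by move=> /cG; rewrite -normr_gt0; exact: lt_le_trans.
have [s sk s0] := zeros_seq dG Gk0.
exists (Z ++ s); split.
- by rewrite size_cat leq_add.
- by rewrite mem_cat pZ.
- by rewrite mem_cat qZ.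
move=> x r /andP[px xq]; rewrite le_eqVlt => /orP[/eqP<- _|r0 rZ].
  by rewrite expr0n mulr0.
have rp : r <= x - p.
  by have := rZ p; rewrite mem_cat pZ gtr0_norm ?subr_gt0//; exact.
have rq : r <= q - x.
  by have := rZ q; rewrite mem_cat qZ distrC gtr0_norm ?subr_gt0//; exact.
pose b := C * c * (r / 2) ^+ k.
have b0 : 0 < b by rewrite mulr_gt0 ?mulr_gt0// exprn_gt0// divr_gt0.
have near_x y : `|y - x| <= r / 2 -> [/\ p < y < q, G 0%N y != 0 & b <= `|G 1%N y|].
  move=> yx; have ypq : p < y < q by move: yx; rewrite ler_norml => /andP[]; lra.
  split=> //.
    apply/eqP => /(s0 _ ypq) ys; have := rZ y.
    by rewrite mem_cat ys orbT distrC => /(_ isT); lra.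
  apply: ZG => //; first by rewrite ltW// divr_gt0.
  move=> z zZ; have := rZ z; rewrite mem_cat zZ => /(_ isT).
  by have := ler_distD y x z; rewrite (distrC x y); lra.
have mid : b * (r / 2) <= `|G 0%N x|.
  apply: (@ge_away_zero _ (G 1%N)) => //; first by rewrite divr_gt0.
  move=> y /near_x[ypq Gy0 bG]; split=> //; exact: dG.
apply: le_trans mid; rewrite /b expr_div_n exprS le_eqVlt; apply/orP; left; apply/eqP.
by rewrite !exprS !invfM; ring.
Qed.

End zeros.

(** * Integrals of inverse powers *)

Section inverse_power.
Variable R : realType.
Local Notation mu := (@lebesgue_measure R).

Lemma inv_power_ge0 (T : Type) (f : T -> R) (a : R) x : (0 <= inv_power f a x)%E.
Proof. by rewrite /inv_power; case: ifP => // _; rewrite lee_fin powR_ge0. Qed.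

Lemma measurable_inv_power d (T : measurableType d) (D : set T)
    (f : T -> measurableTypeR R) (a : R) : measurable D ->
  measurable_fun D f -> measurable_fun D (inv_power f a : T -> \bar R).
Proof.
move=> mD mf.
have mh : measurable_fun [set: measurableTypeR R] (inv_power id a : R -> \bar R).
  apply: measurable_fun_ifT => //.
  - apply: (measurable_fun_bool true).
    by rewrite setTI (_ : _ @^-1` _ = [set 0]) //; apply/seteqP; split => x /= /eqP.
  - apply/measurable_EFinP.
    by apply: (@measurableT_comp _ _ _ _ _ _ (@powR R ^~ (- a))) => //; exact: measurable_powR.
exact: measurableT_comp mh mf.
Qed.

Lemma ge0_integral_preserving d (T : measurableType d)
    (m : {measure set T -> \bar R}) (phi : T -> T) (f : T -> \bar R) :
  measurable_fun setT phi ->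
  (forall A, measurable A -> m (phi @^-1` A) = m A) ->
  measurable_fun setT f -> (forall x, 0 <= f x)%E ->
  (\int[m]_x f (phi x) = \int[m]_x f x)%E.
Proof.
move=> mphi phiE mf f0.
pose m' := measure_function_pushforward__canonical__measure_function_Measure m mphi.
transitivity (\int[m']_x f x)%E.
  by rewrite (ge0_integral_pushforward mphi)// preimage_setT.
by apply: eq_measure_integral => A mA _; exact: phiE.
Qed.

Lemma lebesgue_measure_translation (c : R) (A : set (measurableTypeR R)) : measurable A ->
  mu ((fun x => x + c) @^-1` A) = mu A.
Proof.
move=> mA.
have mc : measurable_fun setT (fun x : measurableTypeR R => x + c : measurableTypeR R).
  exact: measurable_funD.
pose m' := measure_function_pushforward__canonical__measure_function_Measure mu mc.
apply/esym; apply: (@lebesgue_measure_unique _ m')=> //= _ [[a b]] _ <-.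
rewrite /pushforward /= (_ : _ @^-1` _ = `]a - c, b - c]%classic).
  rewrite !lebesgue_measure_itv/= !lte_fin ltrD2r.
  by case: ifP => // _; rewrite -!EFinD; congr EFin; ring.
by apply/seteqP; split => x /=; rewrite !in_itv/= ltrBlDr lerBrDr.
Qed.

Lemma ge0_integral_translation (c : R) (f : R -> \bar R) :
  measurable_fun [set: measurableTypeR R] f -> (forall x, 0 <= f x)%E ->
  (\int[mu]_x f (x + c)%R = \int[mu]_x f x)%E.
Proof.
move=> mf f0; apply: (@ge0_integral_preserving _ (measurableTypeR R) mu (fun x : R => x + c) f) => //.
  exact: measurable_funD.
exact: lebesgue_measure_translation.
Qed.

Lemma ge0_integral_reflection (f : R -> \bar R) :
  measurable_fun [set: measurableTypeR R] f -> (forall x, 0 <= f x)%E ->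
  (\int[mu]_x f (- x)%R = \int[mu]_x f x)%E.
Proof.
move=> mf f0; apply: (@ge0_integral_preserving _ (measurableTypeR R) mu -%R f) => //.
exact: lebesgue_measureN.
Qed.

(** The primitive [x ^ (1 - b) / (1 - b)] is used on compact subintervals, and monotone convergence
    passes to the limit. *)
Lemma integral_powR_le (b : R) : b < 1 ->
  (\int[mu]_(x in `]0%R, 1%R]) (x `^ (- b))%:E <= ((1 - b)^-1)%:E)%E.
Proof.
move=> b1.
(* [n.+2] keeps the interval nondegenerate also for [n = 0]. *)
pose F n : set (measurableTypeR R) := `[n.+2%:R^-1, 1]%classic.
have n01 n : 0 < (n.+2%:R^-1 : R) < 1.
  by rewrite invr_gt0 ltr0n/= invf_lt1// ltr1n.
have -> : `]0%R, 1%R]%classic = \bigcup_n F n.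
  apply/seteqP; split=> x /=.
    rewrite in_itv/= => /andP[x0 x1]; exists (Num.truncn x^-1) => //=.
    rewrite /F/= in_itv/= x1 andbT invf_ple ?posrE ?ltr0n//.
    by rewrite (le_trans (ltW (truncnS_gt _)))// ler_nat.
  move=> [n _]; rewrite /F/= !in_itv/= => /andP[nx ->]; rewrite andbT.
  by apply: lt_le_trans nx; have /andP[] := n01 n.
have ndF : nondecreasing_seq F.
  apply/nondecreasing_seqP => n; apply/subsetPset => x; rewrite /F/= !in_itv/=.
  by move=> /andP[+ ->]; rewrite andbT; apply: le_trans; rewrite lef_pV2 ?posrE// ler_nat.
have mf : measurable_fun [set: measurableTypeR R] (fun x : R => (x `^ (- b))%:E).
  by apply/measurable_EFinP; exact: measurable_powR.
have dP (x p : R) : 0 < x -> is_derive x 1 (fun y : R => y `^ p) (p * x `^ (p - 1)).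
  move=> x0; have x0' : x \in `]0, +oo[ by rewrite in_itv/= x0.
  by apply: DeriveDef; [exact: derivable_powR|rewrite -derive1E powR_derive1].
have FE n : (\int[mu]_(x in F n) (x `^ (- b))%:E <= ((1 - b)^-1)%:E)%E.
  have /andP[n0 n1] := n01 n.
  pose G (x : R) := (1 - b)^-1 * x `^ (1 - b).
  have dG (x : R) : 0 < x -> is_derive x 1 G (x `^ (- b)).
    move=> x0; have := dP x (1 - b) x0 => /(is_deriveZ (1 - b)^-1).
    rewrite /GRing.scale/= mulrA mulVf ?mul1r ?subr_eq0 ?gt_eqF//.
    by rewrite addrAC subrr add0r.
  have cG (x : R) : 0 < x -> {for x, continuous G}.
    by move=> /dG[+ _]; move=> /derivable1_diffP/differentiable_continuous.
  rewrite (@continuous_FTC2 _ _ G)//.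
  - rewrite -EFinB lee_fin /G powR1 mulr1 gerBl mulr_ge0 ?powR_ge0//.
    by rewrite invr_ge0 subr_ge0 ltW.
  - apply: derivable_within_continuous => x; rewrite in_itv/= => /andP[nx _].
    by have [] := dP x (- b) (lt_le_trans n0 nx).
  - split.
    + by move=> x; rewrite in_itv/= => /andP[nx _]; have [] := dG x (lt_trans n0 nx).
    + by apply: cvg_at_right_filter; exact: cG.
    + by apply: cvg_at_left_filter; exact: cG.
  - move=> x; rewrite in_itv/= => /andP[nx _]; rewrite derive1E.
    by have [] := dG x (lt_trans n0 nx).
apply: (cvge_to_le (@ge0_nondecreasing_set_cvg_integral _ _ _ F
  (fun x => (x `^ (- b))%:E) mu ndF _ _ _)).
- by move=> n; exact: measurable_itv.
- by move=> n; exact: measurable_funS mf.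
- by move=> n x _; rewrite lee_fin powR_ge0.
- by near=> n; exact: FE.
Unshelve. all: by end_near. Qed.

Lemma measurable_inv_power_sub (b z : R) :
  measurable_fun [set: measurableTypeR R] (inv_power (fun t : R => t - z) b : R -> \bar R).
Proof. by apply: measurable_inv_power => //; exact: measurable_funB. Qed.

Lemma integral_inv_power_unit (b : R) : b < 1 ->
  (\int[mu]_(t in `[(-1)%R, 1%R]) inv_power id b t <= (2 * (1 - b)^-1)%:E)%E.
Proof.
move=> b1.
have mi : measurable_fun [set: measurableTypeR R] (inv_power id b : R -> \bar R).
  exact: measurable_inv_power.
have right : (\int[mu]_(t in `]0%R, 1%R]) inv_power id b t <= ((1 - b)^-1)%:E)%E.
  apply: le_trans (integral_powR_le b1); rewrite le_eqVlt; apply/orP; left; apply/eqP.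
  apply: eq_integral => t; rewrite inE/= in_itv/= => /andP[t0 _].
  by rewrite /inv_power gt_eqF// gtr0_norm.
have left : (\int[mu]_(t in `[(-1)%R, 0%R]) inv_power id b t <= ((1 - b)^-1)%:E)%E.
  (* The point [0], where the integrand is infinite, is discarded as a null set so that reflection
     carries the interval exactly onto []0, 1]]. *)
  rewrite -integral_itv_bndo_bndc; last exact: measurable_funS mi.
  apply: le_trans right; rewrite le_eqVlt; apply/orP; left; apply/eqP.
  rewrite integral_mkcond [RHS]integral_mkcond.
  rewrite -[RHS]ge0_integral_reflection; first last.
  - by move=> x; apply: erestrict_ge0 => y _; exact: inv_power_ge0.
  - by apply/(measurable_restrictT _ _).1 => //; exact: measurable_funS mi.
  apply: eq_integral => t _; rewrite !patchE.
  have -> : (- t \in `]0, 1]%classic) = (t \in `[(-1)%R, 0%R[%classic).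
    by rewrite !mem_setE !in_itv/= oppr_gt0 lerNl andbC.
  by case: ifP => // _; rewrite /inv_power oppr_eq0 normrN.
have -> : `[(-1)%R, 1%R]%classic = `[(-1)%R, 0%R]%classic `|` `]0%R, 1%R]%classic :> set R.
  by apply/seteqP; split=> x /=; rewrite !in_itv/=; [|move=> []]; lra.
rewrite ge0_integral_setU//=.
- have -> : 2 * (1 - b)^-1 = (1 - b)^-1 + (1 - b)^-1 by rewrite mulr_natl mulr2n.
  by rewrite EFinD; exact: leeD left right.
- exact: measurable_funS mi.
- by move=> x _; exact: inv_power_ge0.
- by apply/disj_setPLR => x /=; rewrite !in_itv/=; lra.
Qed.

(** The bound must not depend on [z]. Within distance [1] of [z] the integrand is a translate of a
    fixed function; farther away it is at most [1] because [0 <= b], which costs at most the length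
    [q - p]. *)
Lemma integral_inv_power_sub (b p q z : R) : 0 <= b < 1 -> p < q ->
  (\int[mu]_(t in `]p, q[) inv_power (fun t => t - z)%R b t <=
    (2 * (1 - b)^-1 + (q - p))%:E)%E.
Proof.
move=> /andP[b0 b1] pq.
pose H : R -> \bar R := (inv_power id b) \_ `[-1, 1].
have mH : measurable_fun [set: measurableTypeR R] H.
  apply/(measurable_restrictT _ _).1 => //.
  by apply: measurable_inv_power => //; exact: measurable_funS (@measurable_id _ _ setT).
have H0 x : (0 <= H x)%E by apply: erestrict_ge0 => y _; exact: inv_power_ge0.
have mHz : measurable_fun [set: measurableTypeR R] (fun t : R => H (t - z)).
  by apply: measurableT_comp mH _; exact: measurable_funB.
have mpq : measurable (`]p, q[%classic : set (measurableTypeR R)) by exact: measurable_itv.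
apply: (@le_trans _ _ (\int[mu]_(t in `]p, q[) (H (t - z)%R + 1))%E).
  apply: ge0_le_integral => //.
  - by move=> t _; exact: inv_power_ge0.
  - exact: measurable_funS (measurable_inv_power_sub b z).
  - by apply: emeasurable_funD => //; exact: measurable_funS mHz.
  move=> t _; rewrite /H patchE mem_setE in_itv/= -ler_norml.
  rewrite /inv_power; have [tz1|tz1] := leP `|t - z| 1; first by rewrite leeDl.
  rewrite add0e ifF; last by apply/negP => /eqP E; move: tz1; rewrite E normr0 ltr10.
  by rewrite lee_fin -(powRr0 `|t - z|) ler_powR ?oppr_le0// ltW.
rewrite ge0_integralD//; last exact: measurable_funS mHz.
rewrite EFinD leeD//; last first.
  rewrite integral_cst// mul1e; apply: (@le_trans _ _ (lebesgue_measure `]p, q[)) => //.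
  by rewrite lebesgue_measure_itv/= lte_fin pq -EFinB.
apply: (@le_trans _ _ (\int[mu]_t H (t + - z)%R)%E).
  by apply: ge0_subset_integral => //; exact: mHz.
rewrite (ge0_integral_translation (- z) mH H0).
by have := integral_inv_power_unit b1; rewrite integral_mkcond.
Qed.
End inverse_power.

Section inverse_power_derivative.
Variable R : realType.
Local Notation mu := (@lebesgue_measure R).

Lemma nearest (Z : seq R) (t : R) : Z != [::] ->
  exists2 z0, z0 \in Z & {in Z, forall z, `|t - z0| <= `|t - z|}.
Proof.
elim: Z => // z [|y s] IH _.
  by exists z; rewrite ?mem_head// => x; rewrite inE => /eqP->.
have [//|z0 z0s z0m] := IH.
have [le|lt] := leP `|t - z| `|t - z0|.
  exists z; rewrite ?mem_head// => x; rewrite inE => /orP[/eqP->//|/z0m].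
  exact: le_trans.
exists z0; first by rewrite inE z0s orbT.
by move=> x; rewrite inE => /orP[/eqP->|/z0m//]; exact: ltW.
Qed.

(** [D] is chosen before [G], [p] and [q], so that it serves all parallel lines at once. It comes
    from [|G 0 t| >= C * c * |t - z| ^ k] for the nearest exceptional point [z], there being at most
    [N] such points. *)
Lemma integral_inv_power_le (k : nat) (a c l : R) : 0 < a -> a * k%:R < 1 -> 0 < c ->
  exists D : R, forall (G : nat -> R -> R) (p q : R), p < q -> q - p <= l ->
  (forall j x, (j < k)%N -> p < x < q -> is_derive x 1 (G j) (G j.+1 x)) ->
  (forall x, p < x < q -> c <= `|G k x|) ->
  measurable_fun (`]p, q[%classic : set (measurableTypeR R)) (G 0%N) ->
  (\int[mu]_(t in `]p, q[) inv_power (G 0%N) a t <= D%:E)%E.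
Proof.
move=> a0 ak1 c0; have [C [C0 [N HN]]] := ge_dist_exceptional R k.
pose K := (C * c) `^ (- a).
have Cc0 : 0 < C * c by rewrite mulr_gt0.
have K0 : 0 < K by rewrite powR_gt0.
pose B := 2 * (1 - a * k%:R)^-1 + l.
exists (K * (B *+ N)) => G p q pq ql dG cG mG.
have [Z [ZN pZ _ ZG]] := HN G p q c c0 dG cG.
have ak0 : 0 <= a * k%:R by rewrite mulr_ge0// ltW.
have B0 : 0 <= B.
  rewrite addr_ge0 ?mulr_ge0 ?invr_ge0 ?subr_ge0 ?ltW//.
  by rewrite (lt_le_trans _ ql)// subr_gt0.
pose F z (t : R) := inv_power (fun t => t - z) (a * k%:R) t.
have F0 z t : (0 <= F z t)%E by exact: inv_power_ge0.
have mpq : measurable (`]p, q[%classic : set (measurableTypeR R)) by exact: measurable_itv.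
have mF z : measurable_fun (`]p, q[%classic : set (measurableTypeR R)) (F z).
  exact: measurable_funS (measurable_inv_power_sub _ _).
(* The nearest point of [Z] varies with [t]; summing over all of [Z] removes this dependence at the
   price of a factor [N]. *)
have pointwise t : p < t < q ->
    (inv_power (G 0%N) a t <= K%:E * \sum_(z <- Z) F z t)%E.
  move=> tpq; have [|z zZ zmin] := @nearest Z t; first by case: Z pZ {ZN ZG}.
  have := ZG t `|t - z| tpq (normr_ge0 _) zmin.
  rewrite (big_rem z zZ)/= => GZ; apply: (@le_trans _ _ (K%:E * F z t)%E); last first.
    by rewrite lee_pmul2l// leeDl// sume_ge0.
  rewrite /F /inv_power; have [tz|tz] := eqVneq (t - z) 0; first by rewrite gt0_muley ?leey.
  have r0 : 0 < C * c * `|t - z| ^+ k by rewrite mulr_gt0// exprn_gt0// normr_gt0.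
  have G0 := lt_le_trans r0 GZ; rewrite normr_gt0 in G0; rewrite (negPf G0).
  rewrite -EFinM lee_fin /K.
  have -> : `|t - z| `^ (- (a * k%:R)) = (`|t - z| ^+ k) `^ (- a).
    by rewrite -powR_mulrn ?normr_ge0// -powRrM mulrN (mulrC a).
  rewrite -powRM ?exprn_ge0 ?normr_ge0 ?(ltW Cc0)//.
  rewrite !powRN lef_pV2 ?posrE ?powR_gt0 ?normr_gt0//.
  by apply: ge0_ler_powR; rewrite ?nnegrE ?normr_ge0 ?(ltW a0) ?(ltW r0).
apply: (@le_trans _ _ (\int[mu]_(t in `]p, q[) (K%:E * \sum_(z <- Z) F z t))%E).
  apply: ge0_le_integral => //.
  - by move=> t _; exact: inv_power_ge0.
  - exact: measurable_inv_power.
  - by apply: measurable_funeM; exact: emeasurable_sum.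
rewrite ge0_integralZl//; last 3 first.
- by apply: emeasurable_sum.
- by move=> t _; exact: sume_ge0.
- by rewrite lee_fin ltW.
rewrite EFinM lee_pmul2l// ge0_integral_sum//.
apply: (@le_trans _ _ (\sum_(z <- Z) B%:E)%E).
  apply: lee_sum => z _; apply: (le_trans (integral_inv_power_sub z _ pq)).
    by rewrite ak0.
  by rewrite lee_fin lerD2l.
rewrite sumEFin lee_fin big_const_seq count_predT iter_addr addr0.
exact: ler_wpMn2l.
Qed.

End inverse_power_derivative.

(** * Lebesgue measure on row vectors: open sets, translations, shears *)

Section lebesgue_rV_theory.
Variable R : realType.
Local Notation mu := (@lebesgue_measure R).
Local Notation lam := (lebesgue_rV R).

(** The sigma-algebra is generated by the coordinates, so an open set is exhibited as a countable
    union of boxes with rational centres and radii [1 / (k + 1)]. *)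
Lemma open_measurable_rV n (U : set 'rV[R]_n) : open U -> measurable U.
Proof.
move=> oU.
pose A (c : 'rV[rat]_n * nat) i : set (measurableTypeR R) :=
  `](ratr (c.1 ord0 i) - c.2.+1%:R^-1), (ratr (c.1 ord0 i) + c.2.+1%:R^-1)[%classic.
pose box c : set 'rV[R]_n := [set x | forall i, A c i (x ord0 i)].
have -> : U = \bigcup_(c in [set c | box c `<=` U]) box c.
  apply/seteqP; split=> [x Ux|x [c]]; last exact.
  have [e /= e0 xeU] := (nbhs_ballP _ _).1 (open_nbhs_nbhs (conj oU Ux)).
  (* The centre will lie within [d] of [x] and the box has radius [d], so [2 d < e] keeps the box
     inside the ball. *)
  have [d [k [dE d0 de]]] : exists d : R, exists k, [/\ d = k.+1%:R^-1, 0 < d & d < e / 2].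
    exists (Num.truncn (2 / e)).+1%:R^-1, (Num.truncn (2 / e)); split; rewrite ?invr_gt0//.
    by rewrite -[e / 2]invf_div ltf_pV2 ?posrE ?divr_gt0// truncnS_gt.
  have qex (i : 'I_n) : exists q : rat,
      (ratr q : R) \in `](x ord0 i - d), (x ord0 i + d)[.
    by apply: rat_in_itvoo; rewrite ltrBlDr -addrA ltrDl addr_gt0.
  have [q qE] := choice qex.
  exists (\row_i q i, k).
    move=> y /= bxy; apply: xeU; split=> // i j.
    have -> : i = ord0 by rewrite [i]ord1; apply: val_inj.
    have := bxy j; have := qE j; rewrite /A/= !in_itv/= mxE -dE => /andP[? ?] /andP[? ?].
    by rewrite /ball/= ltr_norml; apply/andP; split; lra.
  by move=> i /=; have := qE i; rewrite /A/= !in_itv/= mxE -dE => /andP[? ?]; apply/andP; split; lra.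
rewrite bigcup_mkcond; apply: countable_bigcupT_measurable => [|c].
  exact: countableP.
by case: ifP => // _; apply: (measurable_rV_box (A := A c)) => i; exact: measurable_itv.
Qed.


Lemma integral_rV_cons n (f : 'rV[R]_n.+1 -> \bar R) :
  measurable_fun setT f -> (forall x, 0 <= f x)%E ->
  (\int[lam n.+1]_x f x =
   \int[mu]_t \int[lam n]_y f (rV_cons (t, y)))%E.
Proof.
move=> mf f0.
have mfc : measurable_fun setT (f \o @rV_cons R n).
  by apply: (measurableT_comp mf); exact: measurable_rV_cons.
rewrite -(@fubini_tonelli1 _ _ _ _ _ mu (lam n) (f \o @rV_cons R n))//; last first.
  by move=> p; exact: f0.
have := @ge0_integral_pushforward _ _ _ _ R _ (@measurable_rV_cons R n)
  (mu \x lam n)%E setT f measurableT mf (fun x _ => f0 x).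
by rewrite preimage_setT.
Qed.

(** Induction on the dimension: the inner integral absorbs the translation of the last coordinates,
    the outer one that of the first. *)
Lemma ge0_integral_rV_translation n (c : 'rV[R]_n) (f : 'rV[R]_n -> \bar R) :
  measurable_fun setT f -> (forall x, 0 <= f x)%E ->
  (\int[lam n]_x f (x + c)%R = \int[lam n]_x f x)%E.
Proof.
elim: n c f => [|n IH] c f mf f0.
  by apply: eq_integral => x _; congr f; apply/rowP => -[].
have mc : measurable_fun [set: 'rV[R]_n.+1] (fun x : 'rV[R]_n.+1 => f (x + c)).
  apply: (measurableT_comp mf); apply: measurable_fun_rV => i.
  under eq_fun do rewrite mxE.
  by apply: measurable_funD => //; exact: measurable_rV_coord.
rewrite (integral_rV_cons mf f0) (integral_rV_cons mc (fun x => f0 (x + c))).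
pose c' : 'rV[R]_n := \row_i c ord0 (lift ord0 i).
have consD t y : rV_cons (t, y) + c = rV_cons (t + c ord0 ord0, y + c') :> 'rV[R]_n.+1.
  apply/rowP => i; rewrite !mxE; case: unliftP => [j ->|->] /=; rewrite ?mxE//.
have mfc t : measurable_fun setT (fun y : 'rV[R]_n => f (rV_cons (t, y))).
  apply: (measurableT_comp mf); apply: (measurableT_comp (@measurable_rV_cons R n)).
  exact: pair1_measurable.
under eq_integral => t _.
  under eq_integral => y _ do rewrite consD.
  rewrite (IH c' (fun y => f (rV_cons (t + c ord0 ord0, y))))//.
  over.
apply: (ge0_integral_translation (c ord0 ord0)
  (f := fun t => \int[lam n]_y f (rV_cons (t, y)))%E).
  apply: (@measurable_fun_fubini_tonelli_F _ _ _ _ _ (lam n) (f \o @rV_cons R n)) => //.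
  by apply: (measurableT_comp mf); exact: measurable_rV_cons.
- by move=> p; exact: f0.
- by move=> t; apply: integral_ge0 => y _; exact: f0.
Qed.

Lemma measurable_rV_shear n (t0 : R) (v : 'rV[R]_n) :
  measurable_fun [set: measurableTypeR R * 'rV[R]_n]
    (fun p => rV_cons (p.1, p.2 + (p.1 - t0) *: v)).
Proof.
apply: measurable_fun_rV => i.
under eq_fun do rewrite mxE.
case: (unliftP ord0 i) => [j _|_] /=; last exact: measurable_fst.
under eq_fun do rewrite !mxE.
apply: measurable_funD.
  exact: measurableT_comp (measurable_rV_coord j) measurable_snd.
by apply: measurable_funM => //; apply: measurable_funB => //; exact: measurable_fst.
Qed.

(* The shear [(t, y) |-> (t, y + (t - t0) v)] preserves Lebesgue measure and maps
   lines parallel to the first axis to lines of direction [(1, v)]. *)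
Lemma integral_rV_shear n (t0 : R) (v : 'rV[R]_n) (f : 'rV[R]_n.+1 -> \bar R) :
  measurable_fun setT f -> (forall x, 0 <= f x)%E ->
  (\int[lam n.+1]_x f x =
   \int[lam n]_y \int[mu]_t f (rV_cons (t, y + (t - t0) *: v)%R))%E.
Proof.
move=> mf f0; rewrite (integral_rV_cons mf f0).
have mfc t : measurable_fun setT (fun y : 'rV[R]_n => f (rV_cons (t, y))).
  apply: (measurableT_comp mf); apply: (measurableT_comp (@measurable_rV_cons R n)).
  exact: pair1_measurable.
pose g (p : measurableTypeR R * 'rV[R]_n) := f (rV_cons (p.1, p.2 + (p.1 - t0) *: v)).
have mg : measurable_fun setT g.
  exact: (measurableT_comp mf (measurable_rV_shear t0 v)).
(* For fixed [t] the shear is a translation in [y] and leaves the inner integral unchanged; Tonelli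
   then exchanges the order. *)
apply: (eq_trans _ (@fubini_tonelli _ _ _ _ _ mu (lam n) g mg (fun p => f0 _))).
apply: eq_integral => t _; apply/esym.
exact: (ge0_integral_rV_translation ((t - t0) *: v) (mfc t) (fun y => f0 _)).
Qed.

End lebesgue_rV_theory.

Arguments lebesgue_rV R n : simpl never.

(** * Local integrability from a derivative bounded away from zero *)

Section inverse_power_rV.
Variable R : realType.
Local Notation mu := (@lebesgue_measure R).
Local Notation lam := (lebesgue_rV R).

(** The two difference quotients are the same function of [h], so derivability in the single
    direction [u] suffices, without a chain rule. *)
Lemma is_derive_line n (P : R -> 'rV[R]_n) (u : 'rV[R]_n) (f : 'rV[R]_n -> R) (t df : R) :
  (forall h, P (h + t) = h *: u + P t) -> is_derive (P t) u f df ->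
  is_derive t 1 (f \o P) df.
Proof.
move=> PE [fd fE].
have E : (fun h : R => h^-1 *: (((f \o P) \o shift t) (h *: 1) - (f \o P) t)) =
         (fun h : R => h^-1 *: ((f \o shift (P t)) (h *: u) - f (P t))).
  by apply/funext => h /=; rewrite -PE [h%:A]mulr1.
by apply: DeriveDef; [rewrite /derivable E|rewrite /derive E].
Qed.

Lemma lebesgue_rV_ball_lty n (w : 'rV[R]_n) (r : R) : (lam n (ball w r) < +oo)%E.
Proof.
have mI i : measurable (`](w ord0 i - r), (w ord0 i + r)[%classic : set (measurableTypeR R)).
  exact: measurable_itv.
have sub : ball w r `<=` [set x | forall i, `](w ord0 i - r), (w ord0 i + r)[%classic (x ord0 i)].
  move=> x [_ h] i /=; have := h ord0 i; rewrite /ball/= in_itv/= ltr_norml => /andP[? ?].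
  by apply/andP; split; lra.
apply: (@le_lt_trans _ _ (lam n
   [set x | forall i, `](w ord0 i - r), (w ord0 i + r)[%classic (x ord0 i)])).
  apply: le_measure => //; rewrite inE.
    by apply: open_measurable_rV; exact: ball_open.
  exact: (measurable_rV_box mI).
rewrite (lebesgue_rV_box mI) -ge0_fin_numE ?prode_ge0//.
apply: (big_ind (fun x : \bar R => x \is a fin_num)) => // [x y|i _]; first exact: fin_numM.
by rewrite lebesgue_measure_itv/=; case: ifP.
Qed.

Lemma continuous_measurable_rV n (D U : set 'rV[R]_n) (f : 'rV[R]_n -> R) :
  measurable D -> open U -> D `<=` U -> (forall x, U x -> {for x, continuous f}) ->
  measurable_fun D (f : 'rV[R]_n -> measurableTypeR R).
Proof.
move=> mD oU DU cf.
apply: (measurability _ (RGenOInfty.measurableE R)) => _ [_ [a ->] <-].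
have -> : D `&` f @^-1` `]a, +oo[ = D `&` (U `&` f @^-1` `]a, +oo[).
  by apply/seteqP; split=> x /= [Dx]; [split=> //; split=> //; exact: DU|move=> []].
apply: measurableI => //; apply: open_measurable_rV.
rewrite openE => x /= [Ux fx]; apply: filterI; first exact: open_nbhs_nbhs.
by apply: (cf x Ux); apply: open_nbhs_nbhs; split=> //; exact: interval_open.
Qed.

(** [V] is a sheared cube: a line of direction [u] meets it in an interval of the fixed length
    [2 * r] or not at all, so one constant bounds the integrals along all lines. *)
Lemma inv_power_locally_integrable n (k : nat) (a c : R) (U : set 'rV[R]_n.+1)
    (w u : 'rV[R]_n.+1) (G : nat -> 'rV[R]_n.+1 -> R) :
  0 < a -> a * k%:R < 1 -> 0 < c -> open U -> U w -> u ord0 ord0 = 1 ->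
  (forall x, U x -> {for x, continuous (G 0%N)}) ->
  (forall j x, (j < k)%N -> U x -> is_derive x u (G j) (G j.+1 x)) ->
  (forall x, U x -> c <= `|G k x|) ->
  exists V, [/\ open V, V w, V `<=` U &
    (\int[lam n.+1]_(x in V) inv_power (G 0%N) a x < +oo)%E].
Proof.
move=> a0 ak c0 oU Uw u1 cG dG cGk.
pose w0 := w ord0 ord0.
(* The first coordinate of [u'] is [0], hence [T] and [S] preserve the first coordinate and are
   inverse to each other. *)
pose u' : 'rV[R]_n.+1 := u - delta_mx ord0 ord0.
pose v : 'rV[R]_n := \row_i u ord0 (lift ord0 i).
pose T (x : 'rV[R]_n.+1) : 'rV[R]_n.+1 := x - (x ord0 ord0 - w0) *: u'.
pose S (x : 'rV[R]_n.+1) : 'rV[R]_n.+1 := x + (x ord0 ord0 - w0) *: u'.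
have c0x (x : 'rV[R]_n.+1) : (fun y : 'rV[R]_n.+1 => y ord0 ord0 - w0) @ x --> x ord0 ord0 - w0.
  have h := @coord_continuous R 1 n.+1 ord0 ord0 x.
  exact: (cvgB h (cvg_cst w0)).
have cT x : {for x, continuous (fun x : 'rV[R]_n.+1 => x - (x ord0 ord0 - w0) *: u')}.
  by apply: continuousB; [exact: cvg_id|apply: continuousZl; exact: c0x].
have cS x : {for x, continuous (fun x : 'rV[R]_n.+1 => x + (x ord0 ord0 - w0) *: u')}.
  by apply: continuousD; [exact: cvg_id|apply: continuousZl; exact: c0x].
have T0 x : T x ord0 ord0 = x ord0 ord0.
  by rewrite /T !mxE u1 !eqxx subrr mulr0 subr0.
have S0 x : S x ord0 ord0 = x ord0 ord0.
  by rewrite /S !mxE u1 !eqxx subrr mulr0 addr0.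
have TK : cancel T S by move=> x; rewrite /S T0 /T subrK.
have SK : cancel S T by move=> x; rewrite /T S0 /S addrK.
have [r /= r0 rU] : nbhs_ball w (S @^-1` U).
  apply/nbhs_ballP; apply: open_nbhs_nbhs; split.
    by apply: open_comp => // x _; exact: cS.
  by rewrite /= /S subrr scale0r addr0.
pose V := T @^-1` ball w r.
have oV : open V by apply: open_comp => [x _|]; [exact: cT|exact: ball_open].
have Vw : V w by rewrite /V/= /T subrr scale0r subr0; exact: ballxx.
have VU : V `<=` U by move=> x Vx; rewrite -(TK x); exact: rU.
exists V; split=> //.
have cons0 (t : R) (y : 'rV[R]_n) : rV_cons (t, y) ord0 ord0 = t.
  by rewrite mxE unlift_none.
have SE (t : R) (y : 'rV[R]_n) :
    rV_cons (t, y + (t - w0) *: v) = S (rV_cons (t, y)).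
  rewrite /S cons0; apply/rowP => i; rewrite !mxE; case: unliftP => [j ->|->] /=.
    by rewrite !mxE subr0.
  by rewrite (u1 : u 0 ord0 = 1) subrr mulr0 addr0.
pose w' : 'rV[R]_n := \row_i w ord0 (lift ord0 i).
(* Balls are those of the sup norm, hence products. *)
have ballE (t : R) (y : 'rV[R]_n) : ball w r (rV_cons (t, y)) <-> `|t - w0| < r /\ ball w' r y.
  split.
    move=> [_ h]; split.
      by have := h ord0 ord0; rewrite mxE unlift_none/= distrC.
    by split=> // i j; have := h i (lift ord0 j); rewrite !mxE liftK !ord1.
  move=> [h1 [_ h2]]; split=> // i j; rewrite !ord1 mxE.
  case: unliftP => [l ->|->] /=; last by rewrite /ball/= distrC.
  by have := h2 ord0 l; rewrite mxE.
have VE (t : R) (y : 'rV[R]_n) :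
    V (rV_cons (t, y + (t - w0) *: v)) <-> `|t - w0| < r /\ ball w' r y.
  by rewrite SE /V/= SK; exact: ballE.
have mV : measurable V by exact: open_measurable_rV.
have mG : measurable_fun V (G 0%N : _ -> measurableTypeR R).
  exact: continuous_measurable_rV mV oU VU cG.
pose F : 'rV[R]_n.+1 -> \bar R := inv_power (G 0%N) a \_ V.
have mF : measurable_fun setT F.
  have mi : measurable_fun V (inv_power (G 0%N) a : 'rV[R]_n.+1 -> \bar R).
    exact: (@measurable_inv_power R _ _ V (G 0%N) a mV mG).
  exact: ((measurable_restrictT _ mV).1 mi).
have F0 x : (0 <= F x)%E by apply: erestrict_ge0 => y _; exact: inv_power_ge0.
rewrite integral_mkcond (integral_rV_shear w0 v mF F0).
have [D HD] := integral_inv_power_le (2 * r) a0 ak c0.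
pose B : set 'rV[R]_n := ball w' r.
have mB : measurable B by apply: open_measurable_rV; exact: ball_open.
(* [D] is only known as an upper bound; the absolute value supplies the nonnegative factor needed to
   integrate over [y]. *)
have inner y : (\int[mu]_t F (rV_cons (t, y + (t - w0) *: v))%R <=
    `|D|%:E * (\1_B y)%:E)%E.
  pose g j t := G j (rV_cons (t, y + (t - w0) *: v)).
  have [By|nBy] := pselect (B y); last first.
    rewrite indicE memNset// mule0 integral0_eq// => t _.
    by rewrite /F patchE memNset// => /VE[].
  rewrite indicE mem_set// mule1.
  have gU t : w0 - r < t < w0 + r -> U (rV_cons (t, y + (t - w0) *: v)).
    move=> /andP[? ?]; apply: VU; apply/VE; split=> //.
    by rewrite ltr_norml; apply/andP; split; lra.
  have -> : (\int[mu]_t F (rV_cons (t, y + (t - w0) *: v))%R =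
     \int[mu]_(t in `](w0 - r)%R, (w0 + r)%R[) inv_power (g 0%N) a t)%E.
    rewrite [RHS]integral_mkcond; apply: eq_integral => t _; rewrite /F !patchE.
    have -> : (rV_cons (t, y + (t - w0) *: v) \in V) =
      (t \in `](w0 - r)%R, (w0 + r)%R[%classic); last by [].
    apply/idP/idP; rewrite !inE/= in_itv/=.
      by move/VE => [+ _]; rewrite ltr_norml => /andP[? ?]; apply/andP; split; lra.
    move=> /andP[? ?]; apply/VE; split => //.
    by rewrite ltr_norml; apply/andP; split; lra.
  apply: (@le_trans _ _ D%:E); last by rewrite lee_fin ler_norm.
  apply: HD; [lra|lra| | |].
  - move=> j t jk /gU Ut; apply: is_derive_line (dG j _ jk Ut) => h.
    rewrite !SE /S !cons0; apply/rowP => i; rewrite !mxE.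
    case: unliftP => [l ->|->] /=; last by rewrite (u1 : u 0 ord0 = 1) subrr !mulr0 !addr0 mulr1.
    by rewrite subr0; ring.
  - by move=> t /gU; exact: cGk.
  - apply: (measurable_comp mV _ mG).
      move=> _ [t /= tr <-]; rewrite in_itv/= in tr; case/andP: tr => ? ?.
      by apply/VE; split=> //; rewrite ltr_norml; apply/andP; split; lra.
    apply: measurable_funTS.
    exact: (measurableT_comp (measurable_rV_shear w0 v) (pair2_measurable y)).
have mshear := measurableT_comp mF (measurable_rV_shear w0 v).
have mB1 : measurable_fun setT (fun y : 'rV[R]_n => (\1_B y)%:E : \bar R).
  exact/measurable_EFinP/measurable_indic.
apply: (@le_lt_trans _ _ (\int[lam n]_y (`|D|%:E * (\1_B y)%:E))%E).
  apply: ge0_le_integral => //.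
  - by move=> y _; apply: integral_ge0 => t _; exact: F0.
  - exact: (@measurable_fun_fubini_tonelli_G _ _ _ _ _ mu _ mshear (fun p => F0 _)).
  - exact: measurable_funeM.
rewrite ge0_integralZl//; first rewrite integral_indic// setIT.
by rewrite lte_mul_pinfty ?lee_fin ?ltry// lebesgue_rV_ball_lty.
Qed.

End inverse_power_rV.

(** * Partial and directional derivatives *)

Section partial_derivatives.
Variables (R : realType) (n : nat).
Local Notation rV := 'rV[R]_n.+1.
Local Notation e_ i := (delta_mx ord0 i : 'rV[R]_n.+1).
Implicit Types (U : set rV) (f g : rV -> R) (v x y : rV) (i j : 'I_n.+1).

Lemma near_line U x v : open U -> U x -> \forall h \near 0, U (h *: v + x).
Proof.
move=> oU Ux.
have c : {for 0, continuous (fun h : R => h *: v + x)}.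
  apply: continuousD; last exact: cvg_cst.
  by apply: continuousZl; exact: cvg_id.
by apply: (c U); rewrite /= scale0r add0r; exact: open_nbhs_nbhs.
Qed.

Lemma is_derive_ext U f g x v df : open U -> U x -> (forall y, U y -> f y = g y) ->
  is_derive x v f df -> is_derive x v g df.
Proof.
move=> oU Ux fg [fd fE].
pose q (k : rV -> R) (h : R) := h^-1 *: ((k \o shift x) (h *: v) - k x).
have E : {near (0 : R)^', q f =1 q g}.
  apply: cvg_within; have := near_line v oU Ux; apply: filterS => h Uh.
  by rewrite /q /= !fg.
have cf : q f @ 0^' --> df by rewrite -fE; exact: fd.
have cg : q g @ 0^' --> df by apply: cvg_trans cf; exact: near_eq_cvg.
by apply: DeriveDef; [apply/cvg_ex; exists df|apply/cvg_lim].
Qed.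

(** Coordinate steps may have either sign, hence a form symmetric in [t]. *)
Lemma mean_value_signed (F dF : R -> R) (t : R) :
  (forall s : R, `|s| <= `|t| -> is_derive s 1 F (dF s)) ->
  exists2 s, `|s| <= `|t| & F t - F 0 = t * dF s.
Proof.
move=> hF.
have mvt a b : a <= b -> (forall s, a <= s <= b -> `|s| <= `|t|) ->
    exists2 s, a <= s <= b & F b - F a = dF s * (b - a).
  move=> ab st.
  have [||s] := @MVT_segment _ F dF a b ab.
  - by move=> s; rewrite in_itv/= => /andP[? ?]; apply/hF/st; lra.
  - apply: derivable_within_continuous => s; rewrite in_itv/= => /st/hF[]//.
  - by rewrite in_itv/= => sab E; exists s.
have [t0|t0] := leP 0 t.
  have st s : 0 <= s <= t -> `|s| <= `|t|.
    by move=> /andP[? ?]; rewrite !ger0_norm.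
  by have [s /st s1 ->] := mvt 0 t t0 st; exists s => //; rewrite subr0 mulrC.
have st s : t <= s <= 0 -> `|s| <= `|t|.
  by move=> /andP[? ?]; rewrite !ler0_norm ?lerN2// ltW.
have [s /st s1 E] := mvt t 0 (ltW t0) st; exists s => //.
by rewrite -[LHS]opprB E sub0r mulrN opprK mulrC.
Qed.

Definition dird v f : rV -> R := fun x => \sum_i v ord0 i * partial i f x.

Lemma partial_increment f x i (t : R) :
  (forall s : R, `|s| <= `|t| -> derivable f (s *: e_ i + x) (e_ i)) ->
  exists2 s, `|s| <= `|t| & f (t *: e_ i + x) - f x = t * partial i f (s *: e_ i + x).
Proof.
move=> hf; pose P (s : R) : rV := s *: e_ i + x.
have [|s st E] := @mean_value_signed (f \o P) (fun s => partial i f (P s)) t.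
  move=> s st; apply: (is_derive_line (u := e_ i)).
    by move=> h; rewrite /P scalerDl addrA.
  by apply: DeriveDef => //; exact: hf.
by exists s => //; rewrite -E /P/= scale0r add0r.
Qed.

Lemma norm_coord_sum (s : seq 'I_n.+1) v (j : 'I_n.+1) :
  `|(\sum_(i <- s) v ord0 i *: e_ i) ord0 j| <= \sum_(i <- s) `|v ord0 i|.
Proof.
rewrite summxE; apply: (le_trans (ler_norm_sum _ _ _)); apply: ler_sum => i _.
by rewrite !mxE eqxx/=; case: (j == i); rewrite ?mulr1 ?mulr0 ?normr0.
Qed.

Lemma ball_rV x y (r : R) : 0 < r ->
  (forall j, `|y ord0 j| < r) -> ball x r (y + x).
Proof.
move=> r0 h; split=> // i j; rewrite [i]ord1 /ball/= mxE opprD addrCA subrr addr0 normrN.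
exact: h.
Qed.

(* Along a sum of coordinate steps, each step contributes a mean value of one
   partial derivative. *)
Lemma increment_le f x v (r eps h : R) (s : seq 'I_n.+1) : 0 < r ->
  (forall y, ball x r y -> forall i, derivable f y (e_ i) /\
     `|partial i f x - partial i f y| <= eps) ->
  `|h| * \sum_(i <- s) `|v ord0 i| < r ->
  `|f (h *: \sum_(i <- s) v ord0 i *: e_ i + x) - f x -
    h * \sum_(i <- s) v ord0 i * partial i f x| <=
  eps * (`|h| * \sum_(i <- s) `|v ord0 i|).
Proof.
move=> r0 hf; elim: s => [|i s IH].
  by rewrite !big_nil scaler0 add0r => _; rewrite subrr !mulr0 subr0 normr0.
rewrite !big_cons mulrDr => lt_r.
have lt_s : `|h| * \sum_(i <- s) `|v ord0 i| < r.
  by apply: le_lt_trans lt_r; rewrite lerDr mulr_ge0.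
pose z : rV := h *: \sum_(i <- s) v ord0 i *: e_ i + x.
have near_z (t : R) : `|t| <= `|h * v ord0 i| -> ball x r (t *: e_ i + z).
  move=> th; rewrite /z addrA; apply: ball_rV => // j.
  apply: le_lt_trans lt_r; rewrite mxE; apply: (le_trans (ler_normD _ _)); apply: lerD.
    by rewrite -normrM (le_trans _ th)// !mxE eqxx/=; case: (_ == _); rewrite ?mulr1// mulr0 normr0.
  by rewrite mxE normrM ler_wpM2l// norm_coord_sum.
have [t th E] := @partial_increment f z i (h * v ord0 i)
  (fun t th => (hf _ (near_z t th) i).1).
have -> : h *: (v ord0 i *: e_ i + \sum_(j <- s) v ord0 j *: e_ j) + x =
    (h * v ord0 i) *: e_ i + z by rewrite scalerDr scalerA addrA.
have -> : f ((h * v ord0 i) *: e_ i + z) - f x - h * (v ord0 i * partial i f x +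
    \sum_(j <- s) v ord0 j * partial j f x) =
  - (h * v ord0 i * (partial i f x - partial i f (t *: e_ i + z))) +
  (f z - f x - h * \sum_(j <- s) v ord0 j * partial j f x).
  by rewrite mulrDr [X in - X + _]mulrBr -E; ring.
apply: (le_trans (ler_normD _ _)); rewrite [X in _ <= X]mulrDr lerD//; last exact: IH.
by rewrite normrN 2!normrM mulrC ler_wpM2r// ?(hf _ (near_z t th) i).2 ?mulr_ge0.
Qed.

Lemma is_derive_dird U f x v : open U -> U x ->
  (forall i y, U y -> derivable f y (e_ i)) ->
  (forall i, {for x, continuous (partial i f)}) ->
  is_derive x v f (dird v f x).
Proof.
move=> oU Ux df cf.
have vE : v = \sum_i v ord0 i *: e_ i by rewrite [LHS]row_sum_delta.
pose q (h : R) := h^-1 *: ((f \o shift x) (h *: v) - f x).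
have cq : q @ 0^' --> dird v f x.
  apply/cvgrPdist_le => eps eps0.
  (* The summand [1] keeps [B] positive when [v = 0]. *)
  pose B := 1 + \sum_i `|v ord0 i|.
  have B0 : 0 < B by rewrite ltr_pwDl// sumr_ge0.
  have : nbhs x (fun y => forall i, U y /\ `|partial i f x - partial i f y| <= eps / B).
    have H i : nbhs x (fun y => U y /\ `|partial i f x - partial i f y| <= eps / B).
      apply: filterI; first exact: open_nbhs_nbhs.
      by have /cvgrPdist_le := cf i; apply; exact: divr_gt0.
    exact: (@filter_forall _ _ _ (nbhs x) _ H).
  move=> /nbhs_ballP[r /= r0 hr].
  have hf y : ball x r y -> forall i, derivable f y (e_ i) /\
     `|partial i f x - partial i f y| <= eps / B.
    by move=> /hr hy i; have [Uy ?] := hy i; split=> //; exact: df.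
  near=> h.
  have h0 : h != 0 by near: h; exact: nbhs_dnbhs_neq.
  have hB : `|h| * \sum_i `|v ord0 i| < r.
    apply: (@le_lt_trans _ _ (`|h| * B)); first by rewrite ler_wpM2l// lerDr.
    rewrite -ltr_pdivlMr//; near: h; apply: dnbhs0_lt; exact: divr_gt0.
  have := increment_le r0 hf hB; rewrite -vE => le_inc.
  have -> : dird v f x - q h = - (h^-1 * (f (h *: v + x) - f x - h * dird v f x)).
    by rewrite /q /GRing.scale/=; field.
  rewrite normrN normrM normfV mulrC ler_pdivrMr ?normr_gt0//.
  apply: (le_trans le_inc); rewrite mulrCA mulrC ler_wpM2r//.
  by rewrite mulrAC -mulrA ler_piMr ?(ltW eps0)// ler_pdivrMr// mul1r lerDr.
apply: DeriveDef; first by apply/cvg_ex; exists (dird v f x).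
exact: cvg_lim.
Unshelve. all: by end_near. Qed.

End partial_derivatives.

(** * Functions of class C^k and symmetry of second derivatives *)

Section class_C_theory.
Variables (R : realType) (n : nat).
Local Notation rV := 'rV[R]_n.+1.
Local Notation e_ i := (delta_mx ord0 i : 'rV[R]_n.+1).
Implicit Types (U : set rV) (f g : rV -> R) (v x y : rV) (i j : 'I_n.+1).

(** The mean value theorem is used twice: along [e_ i] for the difference of [f] on two parallel
    edges of a square, then along [e_ j] for [partial i f]. *)
Lemma mixed_increment f x i j (r t : R) : `|t| + `|t| < r ->
  (forall y, ball x r y -> derivable f y (e_ i)) ->
  (forall y, ball x r y -> derivable (partial i f) y (e_ j)) ->
  exists2 y, ball x r y &
    f (t *: e_ i + (t *: e_ j + x)) - f (t *: e_ i + x) - (f (t *: e_ j + x) - f x) =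
    t * (t * partial j (partial i f) y).
Proof.
move=> tr df dff.
have r0 : 0 < r by apply: le_lt_trans tr; rewrite addr_ge0.
have coordE (s : R) k (l : 'I_n.+1) : `|(s *: e_ k) ord0 l| <= `|s|.
  by rewrite !mxE eqxx/=; case: (_ == _); rewrite ?mulr1// mulr0 normr0.
have in_ball (s s' : R) : `|s| <= `|t| -> `|s'| <= `|t| ->
    ball x r (s *: e_ i + (s' *: e_ j + x)).
  move=> st s't; rewrite addrA; apply: ball_rV => // l.
  apply: le_lt_trans tr; rewrite mxE (le_trans (ler_normD _ _))// lerD//.
    exact: le_trans (coordE _ _ _) st.
  exact: le_trans (coordE _ _ _) s't.
pose P (c : rV) (s : R) : rV := s *: e_ i + c.
have dP c (s : R) : `|s| <= `|t| -> (c = x \/ c = t *: e_ j + x) ->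
    is_derive s 1 (f \o P c) (partial i f (P c s)).
  move=> st hc; apply: (is_derive_line (u := e_ i)).
    by move=> h; rewrite /P scalerDl addrA.
  apply: DeriveDef => //; apply: df; case: hc => ->; last exact: in_ball.
  by have := in_ball s 0 st; rewrite scale0r add0r; apply; rewrite normr0.
have [s st E] := @mean_value_signed R ((f \o P (t *: e_ j + x)) - (f \o P x))
  (fun s => partial i f (P (t *: e_ j + x) s) - partial i f (P x s)) t
  (fun s st => is_deriveB (dP _ s st (or_intror erefl)) (dP _ s st (or_introl erefl))).
have [s' s't E'] := @partial_increment R n (partial i f) (s *: e_ i + x) j t
  (fun s' s't => dff _ (eq_ind _ (ball x r) (in_ball s s' st s't) _ (addrCA _ _ _))).
exists (s' *: e_ j + (s *: e_ i + x)).
  by rewrite addrCA; exact: in_ball.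
rewrite (addrCA (t *: e_ j)) in E'; rewrite -E'; move: E; rewrite !fctE /P /= !scale0r !add0r => <-; ring.
Qed.

(** The second difference over a small square is symmetric in [i] and [j], so the two mixed
    derivatives take a common value at two points near [x]; continuity at [x] finishes. *)
Lemma partialC U f x i j : open U -> U x ->
  (forall y k, U y -> derivable f y (e_ k)) ->
  (forall y k l, U y -> derivable (partial k f) y (e_ l)) ->
  (forall k l, {for x, continuous (partial k (partial l f))}) ->
  partial i (partial j f) x = partial j (partial i f) x.
Proof.
move=> oU Ux df dff cff; apply/eqP; rewrite -subr_eq0 -normr_le0; apply/ler_addgt0Pr => eps eps0.
rewrite add0r.
have H k l : nbhs x (fun y => `|partial k (partial l f) x - partial k (partial l f) y| <= eps / 2).
  by have /cvgrPdist_le := cff k l; apply; exact: divr_gt0.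
have HU : nbhs x U by exact: open_nbhs_nbhs.
have [r /= r0 hr] := (nbhs_ballP _ _).1 (filterI HU (filterI (H i j) (H j i))).
pose t := r / 3; have t0 : 0 < t by rewrite divr_gt0.
have tr : `|t| + `|t| < r by rewrite gtr0_norm// /t; lra.
have Ur y : ball x r y -> U y by move=> /hr[].
have [y1 y1r E1] := @mixed_increment f x i j r t tr (fun y h => df y i (Ur y h))
  (fun y h => dff y i j (Ur y h)).
have [y2 y2r E2] := @mixed_increment f x j i r t tr (fun y h => df y j (Ur y h))
  (fun y h => dff y j i (Ur y h)).
have E : partial i (partial j f) y2 = partial j (partial i f) y1.
  apply: (mulfI (lt0r_neq0 t0)); apply: (mulfI (lt0r_neq0 t0)).
  apply: (etrans (esym E2)); apply: (etrans _ E1).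
  have -> : t *: e_ j + (t *: e_ i + x) = t *: e_ i + (t *: e_ j + x) by rewrite addrCA.
  move: (f (t *: e_ i + (t *: e_ j + x))) (f (t *: e_ i + x)) (f (t *: e_ j + x)) (f x).
  by move=> a b c d; ring.
have [_ [h2 _]] := hr _ y2r; have [_ [_ h1]] := hr _ y1r; rewrite E in h2.
clear -h1 h2; move: (partial i (partial j f) x) (partial j (partial i f) x)
  (partial j (partial i f) y1) h1 h2 => A B C h1 h2.
have -> : A - B = (A - C) - (B - C) by ring.
by apply: (le_trans (ler_normB _ _)); lra.
Qed.

Lemma continuous_ext U f g x : open U -> U x -> (forall y, U y -> f y = g y) ->
  {for x, continuous f} -> {for x, continuous g}.
Proof.
move=> oU Ux fg cf; have HU : nbhs x U by exact: open_nbhs_nbhs.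
have E : {near nbhs x, f =1 g} by apply: filterS HU => y /fg.
rewrite /prop_for /continuous_at -(fg x Ux).
exact: (cvg_trans (@near_eq_cvg _ _ (nbhs x) _ f g E) cf).
Qed.

(** Formulas for derivatives of sums and multiples are available on [U] only; this lets them be
    substituted for [partial] inside the recursive definition. *)
Lemma class_C_ext k U f g : open U -> (forall y, U y -> f y = g y) ->
  class_C k U f -> class_C k U g.
Proof.
move=> oU; elim: k f g => [|k IH] f g fg [cf df].
  by split=> // x Ux; exact: (continuous_ext oU Ux fg (cf x Ux)).
split; first by move=> x Ux; exact: (continuous_ext oU Ux fg (cf x Ux)).
move=> i; have [dfi Ci] := df i.
have dg x : U x -> is_derive x (e_ i) g (partial i f x).
  by move=> Ux; apply: (is_derive_ext oU Ux fg); apply: DeriveDef; [exact: dfi|].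
split; first by move=> x /dg[].
by apply: IH Ci => x /dg[].
Qed.

Lemma class_C_le k l U f : (k <= l)%N -> class_C l U f -> class_C k U f.
Proof.
elim: k l f => [|k IH] [|l] f //= kl [cf df]; split=> //.
by move=> i; have [? ?] := df i; split=> //; exact: (IH l).
Qed.

Lemma class_C_partial k U f i : class_C k.+1 U f -> class_C k U (partial i f).
Proof. by move=> [_ /(_ i)[]]. Qed.

Lemma class_CD k U f g : open U ->
  class_C k U f -> class_C k U g -> class_C k U (f + g).
Proof.
move=> oU; elim: k f g => [|k IH] f g [cf df] [cg dg].
  by split=> [x Ux|]; [exact: (continuousD (cf x Ux) (cg x Ux))|].
split; first by move=> x Ux; exact: (continuousD (cf x Ux) (cg x Ux)).
move=> i; have [dfi Cfi] := df i; have [dgi Cgi] := dg i; split.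
  by move=> x Ux; apply: derivableD; [exact: dfi|exact: dgi].
apply: class_C_ext (IH _ _ Cfi Cgi) => // x Ux.
by rewrite /partial deriveD; [|exact: dfi|exact: dgi].
Qed.

Lemma class_CZ k U f (c : R) : open U -> class_C k U f -> class_C k U (c \*: f).
Proof.
move=> oU; have cZ g x : {for x, continuous g} -> {for x, continuous (c \*: g)}.
  by move=> cg; exact: (continuousM (@cst_continuous _ _ c x) cg).
elim: k f => [|k IH] f [cf df].
  by split=> [x Ux|]; [exact: cZ (cf x Ux)|].
split; first by move=> x Ux; exact: cZ (cf x Ux).
move=> i; have [dfi Cfi] := df i; split.
  by move=> x Ux; apply: derivableZ; exact: dfi.
apply: class_C_ext (IH _ Cfi) => // x Ux.
by rewrite /partial deriveZ//; exact: dfi.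
Qed.

Lemma class_C0 k U : open U -> class_C k U (cst 0).
Proof.
move=> oU; elim: k => [|k IH]; first by split=> // x Ux; exact: cst_continuous.
split; first by move=> x Ux; exact: cst_continuous.
move=> i; split; first by move=> x _; exact: derivable_cst.
by apply: class_C_ext IH => // x _; rewrite /partial derive_cst.
Qed.

Lemma class_C_sum (I : Type) (s : seq I) k U (F : I -> rV -> R) : open U ->
  (forall i : I, class_C k U (F i)) -> class_C k U (fun x => \sum_(i <- s) F i x).
Proof.
move=> oU CF; elim: s => [|i s IH].
  by apply: class_C_ext (class_C0 k oU) => // x _; rewrite big_nil.
by apply: class_C_ext (class_CD oU (CF i) IH) => // x _; rewrite big_cons.
Qed.

Lemma class_C_dird k U f v : open U -> class_C k.+1 U f -> class_C k U (dird v f).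
Proof.
move=> oU Cf; apply: class_C_sum => // i.
by apply: (class_CZ (f := partial i f)) => //; exact: class_C_partial.
Qed.

Lemma class_C_is_derive U f v x : open U -> U x -> class_C 1 U f ->
  is_derive x v f (dird v f x).
Proof.
move=> oU Ux [_ Cf].
have df i y : U y -> derivable f y (e_ i) by have [+ _] := Cf i; apply.
have cf i : {for x, continuous (partial i f)} by have [_ [+ _]] := Cf i; apply.
exact: (@is_derive_dird R n U f x v oU Ux df cf).
Qed.

End class_C_theory.

(** * Words and multinomial coefficients *)

Section words.
Variable T : finType.

Fixpoint words (j : nat) : seq (seq T) :=
  if j is j'.+1 then [seq i :: w | i <- enum T, w <- words j'] else [:: [::]].

Lemma size_words j w : w \in words j -> size w = j.
Proof.
elim: j w => [|j IH] w /=; first by rewrite inE => /eqP->.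
by move=> /allpairsP[[i u] /= [_ /IH <- ->]].
Qed.

Definition has_tally (al : T -> nat) (w : seq T) := [forall i, count_mem i w == al i].

(** The multinomial coefficient, by recursion on the first letter: the words starting with [i]
    contribute [al i * j!] after multiplication by the factorials, and the [al i] add up to
    [j + 1]. *)
Lemma count_words j (al : T -> nat) : (\sum_i al i = j)%N ->
  (count (has_tally al) (words j) * \prod_i (al i)`! = j`!)%N.
Proof.
elim: j al => [|j IH] al sal /=.
  have al0 i : al i = 0%N by apply/eqP; rewrite -leqn0 -sal (bigD1 i)//= leq_addr.
  rewrite big1 ?muln1; last by move=> i _; rewrite al0.
  by rewrite /has_tally (_ : [forall i, _]) //; apply/forallP => i; rewrite al0.
pose dec i := fun k => (al k - (k == i))%N.
have tallyE i w : has_tally al (i :: w) = (0 < al i)%N && has_tally (dec i) w.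
  apply/forallP/andP => [h|[ai /forallP h] k].
    split; first by have := h i; rewrite /= eqxx => /eqP <-.
    apply/forallP => k; have := h k; rewrite /dec/= => /eqP <-.
    by rewrite [k == i]eq_sym addKn.
  have := h k; rewrite /dec/= => /eqP ->; rewrite [i == k]eq_sym.
  have [->|_] := eqVneq k i; first by rewrite subnKC.
  by rewrite add0n subn0.
have countE : count (has_tally al) (words j.+1) =
    (\sum_(i | (0 < al i)%N) count (has_tally (dec i)) (words j))%N.
  rewrite /= -sum1_count big_mkcond big_allpairs_dep/= big_enum/= [RHS]big_mkcond/=.
  under eq_bigr do rewrite -big_mkcond.
  apply: eq_bigr => i _; case: ifP => ai; last first.
    by rewrite big1// => w; rewrite tallyE ai.
  by rewrite -sum1_count; apply: eq_bigl => w; rewrite tallyE ai.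
move: countE => /= ->; rewrite big_distrl/=.
have decE i : (0 < al i)%N ->
    (count (has_tally (dec i)) (words j) * \prod_k (al k)`! = al i * j`!)%N.
  move=> ai; rewrite -(IH (dec i)); last first.
    apply: succn_inj; rewrite -[RHS]sal (bigD1 i)//= [in RHS](bigD1 i)//=.
    rewrite /dec eqxx -addSn subn1 prednK//; congr addn.
    by apply: eq_bigr => k /negPf->; rewrite subn0.
  rewrite mulnCA; congr muln; rewrite (bigD1 i)//= [in RHS](bigD1 i)//= mulnA; congr muln.
    by rewrite /dec eqxx subn1 -[in LHS](prednK ai) factS prednK.
  by apply: eq_bigr => k /negPf ki; rewrite /dec ki subn0.
rewrite (eq_bigr (fun i => al i * j`!)%N)//.
rewrite -big_distrl/= factS -sal; congr muln.
by rewrite [RHS](bigID (fun i => 0 < al i)%N)/= [X in (_ + X)%N]big1 ?addn0// => i;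
  rewrite -eqn0Ngt => /eqP.
Qed.

End words.

Arguments class_C R n k U f : simpl never.

(** * Iterated directional derivatives as sums over words *)

Section iterated_directional_derivatives.
Variables (R : realType) (n : nat).
Local Notation rV := 'rV[R]_n.+1.
Local Notation e_ i := (delta_mx ord0 i : 'rV[R]_n.+1).
Implicit Types (U : set rV) (f g : rV -> R) (v x y : rV) (i j : 'I_n.+1).
Implicit Types (w : seq 'I_n.+1).

Definition partial_word w f : rV -> R := foldr (@partial R n.+1) f w.

Lemma class_C_partial_word k U f w :
  class_C (size w + k) U f -> class_C k U (partial_word w f).
Proof.
elim: w k => //= i w IH k Cf; apply: class_C_partial; apply: IH.
by rewrite addnS.
Qed.

Lemma partial_eq_on U f g i x : open U -> U x -> (forall y, U y -> f y = g y) ->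
  class_C 1 U f -> partial i f x = partial i g x.
Proof.
move=> oU Ux fg [_ /(_ i)[df _]].
have D : is_derive x (e_ i) f (partial i f x) by apply: DeriveDef; [exact: df|].
by have [_ <-] := is_derive_ext oU Ux fg D.
Qed.

Lemma partial_comm U f i j x : open U -> U x -> class_C 2 U f ->
  partial i (partial j f) x = partial j (partial i f) x.
Proof.
move=> oU Ux [_ Cf].
have df y k : U y -> derivable f y (e_ k) by have [+ _] := Cf k; apply.
have dff y k l : U y -> derivable (partial k f) y (e_ l).
  by have [_ [_ /(_ l)[+ _]]] := Cf k; apply.
have cff k l : {for x, continuous (partial k (partial l f))}.
  by have [_ [_ /(_ k)[_ [+ _]]]] := Cf l; apply.
exact: (partialC i j oU Ux df dff cff).
Qed.

Lemma partial_word_move U f i w w' x : open U -> U x ->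
  class_C (size (i :: w ++ w')) U f ->
  partial_word (i :: w ++ w') f x = partial_word (w ++ i :: w') f x.
Proof.
move=> oU; elim: w x => //= j w IH x Ux Cf.
transitivity (partial j (partial_word (i :: w ++ w') f) x).
  apply: (partial_comm _ _ oU Ux); apply: class_C_partial_word.
  by rewrite addnC.
apply: (partial_eq_on _ oU Ux).
  by move=> y Uy; apply: IH => //; apply: class_C_le Cf; rewrite /= leqnSn.
by apply: class_C_partial_word; rewrite addnC.
Qed.

(** The head of [w1] is located in [w2] and brought to the front by swaps of neighbours; equality on
    all of [U] is carried along so that it can be differentiated again. *)
Lemma partial_word_perm U f w1 w2 x : open U -> U x ->
  class_C (size w1) U f -> perm_eq w1 w2 ->
  partial_word w1 f x = partial_word w2 f x.
Proof.
move=> oU; elim: w1 w2 x => [|i w1 IH] w2 x Ux Cf.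
  by rewrite perm_sym => /perm_nilP->.
move=> pw; have iw2 : i \in w2 by rewrite -(perm_mem pw) mem_head.
case/splitPr: iw2 pw => a b pw.
have pab : perm_eq w1 (a ++ b).
  rewrite -(perm_cons i); apply: (perm_trans pw).
  by rewrite -[i :: b]cat1s perm_catCA cat1s.
have sab : size (a ++ b) = size w1 by rewrite (perm_size pab).
rewrite -(partial_word_move oU Ux); last by rewrite /= sab.
apply: (partial_eq_on _ oU Ux).
  by move=> y Uy; apply: IH => //; apply: class_C_le Cf.
by apply: class_C_partial_word; rewrite addn1.
Qed.

(** The particular order of differentiation built into [partialn]. *)
Definition word_of (al : 'I_n.+1 -> nat) : seq 'I_n.+1 :=
  flatten [seq nseq (al i) i | i <- enum 'I_n.+1].

Lemma partialnE (al : 'I_n.+1 -> nat) f : partialn al f = partial_word (word_of al) f.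
Proof.
rewrite /partialn /partial_word /word_of; elim: (enum _) => //= i s ->.
rewrite foldr_cat; move: (foldr _ f _) => g.
by elim: (al i) => //= k ->.
Qed.

Lemma count_word_of (al : 'I_n.+1 -> nat) i : count_mem i (word_of al) = al i.
Proof.
rewrite /word_of count_flatten -map_comp sumnE big_map big_enum/= (bigD1 i)//=.
rewrite count_nseq/= eqxx mul1n big1 ?addn0// => k ki.
by rewrite count_nseq/= (negPf ki) mul0n.
Qed.

Lemma has_tally_perm (al : 'I_n.+1 -> nat) w : has_tally al w -> perm_eq w (word_of al).
Proof.
move=> /forallP h; apply/allP => i _ /=; rewrite count_word_of; exact: h.
Qed.

Lemma partial_sum U (I : eqType) (s : seq I) (c : I -> R) (F : I -> rV -> R) i x :
  open U -> U x -> {in s, forall a, class_C 1 U (F a)} ->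
  is_derive x (e_ i) (fun y => \sum_(a <- s) c a * F a y)
    (\sum_(a <- s) c a * partial i (F a) x).
Proof.
move=> oU Ux; elim: s => [|a s IH] CF.
  have -> : (fun y : rV => \sum_(a <- [::]) c a * F a y) = cst 0.
    by apply/funext => y; rewrite big_nil.
  by rewrite big_nil; exact: is_derive_cst.
have -> : (fun y : rV => \sum_(b <- a :: s) c b * F b y) =
    (c a \*: F a) + (fun y => \sum_(b <- s) c b * F b y).
  by apply/funext => y; rewrite big_cons.
rewrite big_cons; apply: is_deriveD; last first.
  by apply: IH => b bs; apply: CF; rewrite inE bs orbT.
apply: is_deriveZ; apply: DeriveDef => //.
by have [_ /(_ i)[+ _]] := CF a (mem_head _ _); apply.
Qed.

Lemma class_C_iter_dird k (j : nat) U f v : open U -> class_C (j + k) U f ->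
  class_C k U (iter j (dird v) f).
Proof.
move=> oU; elim: j k => //= j IH k Cf; apply: class_C_dird => //; apply: IH.
by rewrite addnS.
Qed.

Lemma iter_dirdE (j : nat) U f v x : open U -> U x -> class_C j U f ->
  iter j (dird v) f x =
  \sum_(w <- words 'I_n.+1 j) (\prod_(i <- w) v ord0 i) * partial_word w f x.
Proof.
move=> oU; elim: j x => [|j IH] x Ux Cf; first by rewrite /= big_seq1 big_nil mul1r.
rewrite [LHS]/= {1}/dird.
have Cw : {in words 'I_n.+1 j, forall w, class_C 1 U (partial_word w f)}.
  by move=> w /size_words sw; apply: class_C_partial_word; rewrite sw addn1.
rewrite /= big_allpairs_dep/= big_enum/=; apply: eq_bigr => i _.
have C1 : class_C 1 U (iter j (dird v) f) by apply: class_C_iter_dird; rewrite ?addn1.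
rewrite (partial_eq_on i oU Ux (fun y Uy => IH y Uy (class_C_le (leqnSn j) Cf)) C1).
have [_] := partial_sum (fun w => \prod_(i <- w) v ord0 i) i oU Ux Cw.
rewrite -[LHS]/(partial i _ x) => ->; rewrite big_distrr/=.
by apply: eq_bigr => w _; rewrite big_cons mulrA.
Qed.

(** Words with the same tally give the same derivative, and their number is the weight [j! / al!] of
    the smoothness condition. The bound [b] concerns coordinates, since a word of length [j]
    contributes a product of [j] of them. *)
Lemma norm_iter_dird_le (j : nat) U f v x (b : R) : open U -> U x -> class_C j U f ->
  (forall i, `|v ord0 i| <= b) ->
  `|iter j (dird v) f x| <= b ^+ j *
    \sum_(al : {ffun 'I_n.+1 -> 'I_j.+1} | (\sum_i (al i : nat) == j)%N)
      j`!%:R / (\prod_i (al i)`!)%N%:R * `|partialn (fun i => al i) f x|.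
Proof.
move=> oU Ux Cf vb.
have b0 : 0 <= b by apply: le_trans (vb ord0); exact: normr_ge0.
have vw w : `|\prod_(i <- w) v ord0 i| <= b ^+ size w.
  elim: w => [|i w IHw]; first by rewrite big_nil normr1.
  by rewrite big_cons normrM exprS ler_pM.
rewrite (iter_dirdE v oU Ux Cf); apply: (le_trans (ler_norm_sum _ _ _)).
apply: (@le_trans _ _ (b ^+ j * \sum_(w <- words 'I_n.+1 j) `|partial_word w f x|)).
  rewrite mulr_sumr big_seq [X in _ <= X]big_seq; apply: ler_sum => w /size_words sw.
  by rewrite normrM ler_wpM2r// (le_trans (vw w))// sw.
rewrite ler_wpM2l ?exprn_ge0// le_eqVlt; apply/orP; left; apply/eqP.
pose tally w : {ffun 'I_n.+1 -> 'I_j.+1} := [ffun i => inord (count_mem i w)].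
have tallyE w i : size w = j -> tally w i = count_mem i w :> nat.
  by move=> sw; rewrite ffunE inordK// ltnS -sw count_size.
have sum_tally w : w \in words 'I_n.+1 j -> (\sum_i (tally w i : nat) == j)%N.
  move=> /size_words sw; under eq_bigr do rewrite tallyE//.
  rewrite -[X in _ == X]sw; apply/eqP.
  elim: w {sw} => [|i w IHw]; first by rewrite big1.
  rewrite /= big_split/= IHw -[RHS]add1n; congr addn.
  by rewrite (bigD1 i)//= eqxx big1 ?addn0// => k /negPf; rewrite eq_sym => ->.
rewrite big_seq (partition_big tally (fun al => (\sum_i (al i : nat) == j)%N))//=.
apply: eq_bigr => al /eqP sal.
have eq_tally w : (w \in words 'I_n.+1 j) && (tally w == al) =
    (w \in words 'I_n.+1 j) && has_tally (fun i => al i : nat) w.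
  apply: andb_id2l => /size_words sw; apply/eqP/forallP => [<- i|h].
    by rewrite tallyE.
  by apply/ffunP => i; apply: val_inj; rewrite /= tallyE//; exact/eqP.
rewrite (eq_bigl _ _ eq_tally).
rewrite (eq_bigr (fun=> `|partialn (fun i => al i) f x|)); last first.
  move=> w /andP[/size_words sw /has_tally_perm pw]; rewrite partialnE.
  by rewrite (partial_word_perm oU Ux _ pw) ?sw.
rewrite -big_seq_cond big_const_seq iter_addr addr0 -[LHS]mulr_natl; congr (_ * _).
have prod0 : (\prod_i (al i)`!)%N%:R != 0 :> R.
  by rewrite pnatr_eq0 -lt0n prodn_gt0// => i; exact: fact_gt0.
apply: (mulIf prod0); rewrite mulfVK// -natrM; congr (_%:R).
exact: count_words.
Qed.

End iterated_directional_derivatives.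

(** * Local integrability and the conclusion *)

Section degree_theory.
Variable R : realType.

(** [infimum] is a choice among infima with default [0]; antisymmetry identifies the chosen one with
    the minimum. *)
Lemma nat_infimum_mem (A : set nat) : A !=set0 -> A (infimum 0%N A).
Proof.
move=> [k Ak]; have /asboolP kA := Ak.
have ex : exists k, `[< A k >] by exists k.
case: (ex_minnP ex) => m /asboolP Am mmin.
have infm : infimums A m.
  split=> [l /asboolP Al|l Al]; last exact: Al.
  by have := mmin l Al.
rewrite /infimum; case: ifPn => [/eqP A0|_]; first by move: Ak; rewrite A0.
have [lb ub] := xgetI 0%N infm.
suff -> : xget 0%N (infimums A) = m by [].
by apply/eqP; rewrite eq_le (lb _ Am)/= ub//; case: infm.
Qed.

Lemma nat_supremum_mem (A : set nat) (B : nat) : A !=set0 ->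
  (forall k, A k -> (k <= B)%N) ->
  A (supremum 0%N A) /\ forall k, A k -> (k <= supremum 0%N A)%N.
Proof.
move=> [k Ak] AB.
have ex : exists k, `[< A k >] by exists k; exact/asboolP.
have bd l : `[< A l >] -> (l <= B)%N by move=> /asboolP; exact: AB.
case: (ex_maxnP ex bd) => m /asboolP Am mmax.
have mmax' l : A l -> (l <= m)%N by move=> Al; apply: mmax; exact/asboolP.
have supm : supremums A m by split=> [l /mmax'//|l]; exact.
suff -> : supremum 0%N A = m by [].
rewrite /supremum; case: ifPn => [/eqP A0|_]; first by move: Ak; rewrite A0.
have [ub lb] := xgetI 0%N supm.
by apply/eqP; rewrite eq_le (ub _ Am) andbT lb//; case: supm.
Qed.

Lemma le_index0 (A b : R) : ln (A / b) <= (index0 A b)%:R.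
Proof.
apply: (@nat_infimum_mem [set j : nat | ln (A / b) <= j%:R]).
by exists (Num.truncn (ln (A / b))).+1 => /=; rewrite ltW// truncnS_gt.
Qed.

(** The supremum [m] is attained, so the sum one term further, up to [m + 1], is no longer below
    [expR 1]; and [j0 <= m] because the sum up to [j0] is empty. *)
Lemma degree_halfE (mu : nat -> R) (A a b : R) :
  (forall j, (0 < j)%N -> 0 < mu j) -> admissible_tuple mu A a b ->
  exists m : nat, [/\ degreeN mu A a b = (2 * m)%N, (index0 A b <= m)%N &
    expR 1 <= \sum_((index0 A b).+1 <= j < m.+2) (a * mu j)^-1].
Proof.
move=> mu0 [A0 a0 b0 sum_gt]; set j0 := index0 A b in sum_gt *.
pose S k : R := \sum_(j0.+1 <= j < k.+1) (a * mu j)^-1.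
have term0 j : (0 < j)%N -> 0 <= (a * mu j)^-1.
  by move=> j_gt0; rewrite invr_ge0 mulr_ge0 ?(ltW a0)// ltW// mu0.
have S_mono k l : (k <= l)%N -> S k <= S l.
  move=> kl; rewrite /S; have [kj|jk] := leqP k j0.
    rewrite big_geq// big_nat_cond sumr_ge0// => j /andP[/andP[jj _] _].
    by rewrite term0// (leq_trans _ jj).
  rewrite (@big_cat_nat _ _ _ k.+1 j0.+1 l.+1)//=; last by rewrite ltnW.
  rewrite lerDl big_nat_cond sumr_ge0// => j /andP[/andP[jj _] _].
  by rewrite term0// (leq_trans _ jj).
have [B eB] : exists B, expR 1 <= S B.
  (* If every partial sum stayed below [expR 1], the series of the inverse weights would be at most
     [a * expR 1], contrary to admissibility. *)
  apply: contrapT => /forallNP H; move: sum_gt; apply/negP; rewrite -leNgt.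
  apply: lime_le.
    apply: is_cvg_nneseries => j jj _; rewrite lee_fin invr_ge0 ltW// mu0//.
    exact: leq_trans jj.
  apply: nearW => -[|k]; first by rewrite big_geq// lee_fin mulr_ge0 ?expR_ge0// ltW.
  rewrite sumEFin lee_fin; have /negP := H k; rewrite -ltNge => /ltW.
  rewrite -(ler_pM2l a0); congr (_ <= _).
  by rewrite /S mulr_sumr; apply: eq_bigr => j _; rewrite invfM mulrA divff ?mul1r ?gt_eqF.
have [||Am mmax] := @nat_supremum_mem [set k | S k < expR 1] B.
- by exists j0 => /=; rewrite /S big_geq// expR_gt0.
- move=> k /= Sk; rewrite leqNgt; apply/negP => /ltnW /S_mono /(le_trans eB).
  by rewrite leNgt Sk.
exists (supremum 0%N [set k | S k < expR 1]); split=> //.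
- by apply: mmax => /=; rewrite /S big_geq// expR_gt0.
- rewrite leNgt; apply/negP => H.
  by have := mmax _ H; rewrite ltnn.
Qed.

End degree_theory.

(** * Segments, diameters and normalized directions *)

Section lower_bounds.
Variables (R : realType) (n : nat).
Local Notation rV := 'rV[R]_n.+1.
Local Notation e_ i := (delta_mx ord0 i : 'rV[R]_n.+1).
Implicit Types (U K L : set rV) (f : rV -> R) (u v w x y : rV) (i : 'I_n.+1).

Lemma convex_segment L x y (t : R) : @convex_set R rV L -> L x -> L y -> 0 <= t <= 1 ->
  L (t *: (y - x) + x).
Proof.
move=> cL Lx Ly t01.
case/andP: t01 => t0 t1.
have := cL y x (Itv01 t0 t1) (mem_set Ly) (mem_set Lx); rewrite inE.
suff -> : conv (Itv01 t0 t1) (y : convex_lmodType rV) x = t *: (y - x) + x by [].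
transitivity (t *: y + (1 - t) *: x); first by [].
by rewrite scalerBr scalerBl scale1r addrAC addrA.
Qed.

Lemma norm_coord_le_enorm x i : `|x ord0 i| <= enorm x.
Proof.
rewrite /enorm -sqrtr_sqr ler_sqrt ?sumr_ge0// => [|j _]; last exact: sqr_ge0.
by rewrite (bigD1 i)//= lerDl sumr_ge0// => j _; exact: sqr_ge0.
Qed.

(** A [sup] bounds its set only if that set is bounded; compactness bounds each coordinate on [K],
    hence all distances. *)
Lemma enorm_le_diam K x y : compact K -> K x -> K y -> enorm (x - y) <= diam K.
Proof.
move=> cK Kx Ky.
have K0 : K !=set0 by exists x.
have cb i : exists c : R, forall z, K z -> `|z ord0 i| <= c.
  have cf : continuous (fun z : rV => `|z ord0 i|).
    by move=> z; apply: continuous_comp; [exact: coord_continuous|exact: norm_continuous].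
  have [c _ hc] := EVT_max_rV K0 cK (continuous_subspaceT cf).
  by exists `|c ord0 i| => z Kz; apply: hc; rewrite inE.
have [c hc] := choice cb.
apply: sup_upper_bound; last by exists x => //; exists y.
split; first by exists (enorm (x - y)), x => //; exists y.
exists (Num.sqrt (\sum_i (c i + c i) ^+ 2)) => _ [a Ka [b Kb <-]].
rewrite ler_sqrt ?sumr_ge0// => [|i _]; last exact: sqr_ge0.
apply: ler_sum => i _; rewrite !mxE -[X in X <= _]real_normK ?num_real//.
have h : `|a ord0 i - b ord0 i| <= c i + c i.
  by rewrite (le_trans (ler_normB _ _))// lerD// hc.
by rewrite lerXn2r// nnegrE//; apply: le_trans h.
Qed.

Lemma diam_le_a_const (d : nat) K : diam K <= a_const d K.
Proof.
rewrite /a_const; case: ifP => // d2.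
have q1 : 1 <= d.+1%:R ^+ d.+1 / d.-1%:R ^+ d.-1 :> R.
  have d1 : (0 < d.-1)%N by case: d d2 => [|[]].
  rewrite ler_pdivlMr ?mul1r ?exprn_gt0 ?ltr0n// -!natrX ler_nat.
  apply: (@leq_trans (d.+1 ^ d.-1)%N).
    by rewrite leq_exp2r// (leq_trans (leq_pred _)).
  by rewrite leq_exp2l//; case: d d2 {d1} => //= d _; rewrite (leq_trans (leqnSn _)).
apply: (@le_trans _ _ (Num.max (diam K) 1)); first by rewrite le_max lexx.
rewrite ler_peMl//; first by rewrite le_max ler01 orbT.
by move: q1; set q := _ / _; lra.
Qed.

Lemma continuous_big_sum (I : Type) (s : seq I) (F : I -> R -> R) (t : R) :
  (forall a, {for t, continuous (F a)}) ->
  {for t, continuous (fun x : R => \sum_(a <- s) F a x)}.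
Proof.
move=> cF; elim: s => [|a s IH].
  have -> : (fun x : R => \sum_(a <- [::]) F a x) = cst 0 by apply/funext => x; rewrite big_nil.
  exact: cst_continuous.
have -> : (fun x : R => \sum_(b <- a :: s) F b x) = F a + (fun x : R => \sum_(b <- s) F b x).
  by apply/funext => x; rewrite big_cons.
exact: continuousD (cF a) IH.
Qed.

Lemma continuous_big_prod (I : Type) (s : seq I) (F : I -> R -> R) (t : R) :
  (forall a, {for t, continuous (F a)}) ->
  {for t, continuous (fun x : R => \prod_(a <- s) F a x)}.
Proof.
move=> cF; elim: s => [|a s IH].
  have -> : (fun x : R => \prod_(a <- [::]) F a x) = cst 1 by apply/funext => x; rewrite big_nil.
  exact: cst_continuous.
have -> : (fun x : R => \prod_(b <- a :: s) F b x) = F a * (fun x : R => \prod_(b <- s) F b x).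
  by apply/funext => x; rewrite big_cons.
exact: continuousM (cF a) IH.
Qed.

(** The [k]-th derivative in direction [v + s e_0] is a polynomial in [s], so it survives a small
    change of [s] that makes the first coordinate nonzero; homogeneity of degree [k] then allows
    rescaling. *)
Lemma normalize_direction (k : nat) U f v w : open U -> U w -> class_C k U f ->
  iter k (dird v) f w != 0 ->
  exists u, u ord0 ord0 = 1 /\ iter k (dird u) f w != 0.
Proof.
move=> oU Uw Cf fv.
pose p (s : R) := \sum_(a <- words 'I_n.+1 k)
  (\prod_(i <- a) (v + s *: e_ ord0) ord0 i) * partial_word a f w.
have pE s : iter k (dird (v + s *: e_ ord0)) f w = p s by exact: (iter_dirdE _ oU Uw Cf).
have p0 : p 0 != 0 by rewrite -pE scale0r addr0.
have cp : {for 0, continuous p}.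
  apply: continuous_big_sum => a.
  apply: continuousM; last exact: cst_continuous.
  apply: continuous_big_prod => i.
  have -> : (fun s : R => (v + s *: e_ ord0) ord0 i) =
      (fun s => v ord0 i + s * e_ ord0 ord0 i) by apply/funext => s; rewrite !mxE.
  apply: continuousD; first exact: cst_continuous.
  by apply: continuousM; [exact: cvg_id|exact: cst_continuous].
have [s ps vs] : exists2 s, p s != 0 & v ord0 ord0 + s != 0.
  have [v0|v0] := eqVneq (v ord0 ord0) 0; last by exists 0; rewrite ?addr0.
  have /cvgrPdist_lt /(_ `|p 0|) := cp; rewrite normr_gt0 => /(_ p0).
  move=> /nbhs_ballP[r /= r0 hr]; exists (r / 2); last first.
    by rewrite v0 add0r gt_eqF// divr_gt0.
  have rb : ball 0 r (r / 2) by rewrite /ball/= sub0r normrN gtr0_norm ?divr_gt0//; lra.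
  by apply/eqP => E; have /= := hr _ rb; rewrite E subr0 ltxx.
pose c := v ord0 ord0 + s.
exists (c^-1 *: (v + s *: e_ ord0)); split.
  by rewrite !mxE !eqxx mulr1 mulVf.
rewrite (iter_dirdE _ oU Uw Cf).
have -> : \sum_(a <- words 'I_n.+1 k)
    (\prod_(i <- a) (c^-1 *: (v + s *: e_ ord0)) ord0 i) * partial_word a f w =
    c^-1 ^+ k * p s.
  rewrite /p mulr_sumr; apply: eq_big_seq => a /size_words <-; rewrite mulrA; congr (_ * _).
  elim: a => [|i a IH]; first by rewrite !big_nil mulr1.
  by rewrite !big_cons IH exprS [X in X * _]mxE; ring.
by rewrite mulf_neq0// expf_neq0// invr_eq0.
Qed.

End lower_bounds.

Section local_integrability.
Variables (R : realType) (n : nat).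
Local Notation rV := 'rV[R]_n.+1.
Implicit Types (U K L : set rV) (f : rV -> R) (u v w x y : rV).

Lemma smooth_le mu (N : option nat) (M0 : R) L f j x : smooth mu N M0 L f ->
  le_order j N -> L x ->
  \sum_(al : {ffun 'I_n.+1 -> 'I_j.+1} | (\sum_i (al i : nat) == j)%N)
     j`!%:R / (\prod_i (al i)`!)%N%:R * `|partialn (fun i => al i) f x|
  <= weight_seq mu M0 j.
Proof.
move=> [_ /(_ j) H] jN Lx; rewrite -lee_fin; apply: le_trans (H jN).
by apply: ereal_sup_ubound; exists x.
Qed.

(** Otherwise [bang], applied on the segment from [w] to [w0] with [m + 1] vanishing orders and
    weight ratios [a * mu j], would make [|f w0|] smaller than [M0 * expR (- j0)]. *)
Lemma nonzero_directional_derivative U L f (mu : nat -> R) (M0 a : R) (j0 m : nat)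
    (w0 w : rV) : open U -> L `<=` U -> @convex_set R rV L ->
  class_C m.+1 U f -> smooth mu (Some m.+1) M0 L f ->
  0 < M0 -> 0 < a -> (forall j, 0 < mu j.+1) ->
  (forall i j, (i <= j)%N -> mu i.+1 <= mu j.+1) ->
  (0 < j0 <= m)%N -> expR 1 <= \sum_(j0.+1 <= j < m.+2) (a * mu j)^-1 ->
  L w0 -> L w -> (forall i, `|(w0 - w) ord0 i| <= a) ->
  M0 * expR (- j0%:R) <= `|f w0| ->
  exists2 k, (k <= m)%N & iter k (dird (w0 - w)) f w != 0.
Proof.
move=> oU LU cL Cf sf M00 a0 mu0 mono /andP[j00 j0m] sume Lw0 Lw wa fw0.
apply: contrapT => nex.
have zero k : (k < m.+1)%N -> iter k (dird (w0 - w)) f w = 0.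
  by move=> km; apply/eqP/negPn/negP => h; apply: nex; exists k.
pose P (t : R) : rV := t *: (w0 - w) + w.
have LP (t : R) : 0 <= t <= 1 -> L (P t) by exact: convex_segment.
have ws0 j : 0 < weight_seq mu M0 j.
  rewrite /weight_seq mulr_gt0//; elim: j => [|j IH]; first by rewrite big_geq.
  by rewrite big_nat_recr//= mulr_gt0.
have := @bang R (fun j => iter j (dird (w0 - w)) f \o P)
  (fun j => a ^+ j * weight_seq mu M0 j) (fun j => a * mu j) m.+1 j0.
have P1 : P 1 = w0 by rewrite /P scale1r subrK.
rewrite /= P1 => B; move: fw0; apply/negP; rewrite -ltNge.
have -> : M0 = 1 * weight_seq mu M0 0 by rewrite mul1r /weight_seq big_geq ?mulr1.
apply: B => //.
- by move=> j; rewrite mulr_gt0// exprn_gt0.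
- by move=> j; rewrite /weight_seq exprSr big_nat_recr//=; ring.
- by move=> j; rewrite mulr_gt0.
- by move=> i j ij; rewrite ler_pM2l// mono.
- move=> j t jm t01; apply: (is_derive_line (u := w0 - w)).
    by move=> h; rewrite /P scalerDl addrA.
  apply: (class_C_is_derive _ oU (LU _ (LP _ t01))).
  apply: class_C_iter_dird => //; apply: class_C_le Cf; by rewrite addn1.
- move=> j t jm t01; have Lt := LP _ t01.
  apply: (le_trans (norm_iter_dird_le oU (LU _ Lt) (class_C_le jm Cf) wa)).
  by rewrite ler_wpM2l ?exprn_ge0 ?(ltW a0)//; exact: (smooth_le sf).
- by move=> j jm; rewrite /P scale0r add0r zero.
- by rewrite j00 leqW.
Qed.

Lemma inv_power_near_nonzero (k : nat) U f v w (al : R) : open U -> U w ->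
  class_C k U f -> iter k (dird v) f w != 0 -> 0 < al -> al * k%:R < 1 ->
  exists V, [/\ open V, V w, V `<=` U &
    (\int[lebesgue_rV R n.+1]_(x in V) inv_power f al x < +oo)%E].
Proof.
move=> oU Uw Cf fv al0 alk.
have [u [u1 fu]] := normalize_direction oU Uw Cf fv.
pose G j := iter j (dird u) f.
have CG j l : (j + l <= k)%N -> class_C l U (G j).
  by move=> jl; apply: class_C_iter_dird => //; exact: class_C_le Cf.
have cGk : {for w, continuous (G k)}.
  by have [+ _] := CG k 0%N (eq_leq (addn0 k)); apply.
pose c := `|G k w| / 2.
have c0 : 0 < c by rewrite divr_gt0// normr_gt0.
have nearc : nbhs w (fun x => c <= `|G k x|).
  have /cvgrPdist_lt /(_ c c0) := cGk; apply: filterS => x h.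
  have := ler_distD 0 (G k w) (G k x); rewrite subr0 sub0r normrN.
  have := lerB_dist (G k w) (G k x); rewrite /c in h *; lra.
pose U' : set rV := U `&` (fun x => c <= `|G k x|)°.
have oU' : open U' by apply: openI => //; exact: open_interior.
have U'w : U' w by [].
have [|||V [oV Vw VU' V_fin]] := @inv_power_locally_integrable R n k al c U' w u G
  al0 alk c0 oU' U'w u1 _ _ _.
- by move=> x [Ux _]; have [+ _] := CG 0%N 0%N (leq0n k); apply.
- move=> j x jk [Ux _]; have j1 : (j + 1 <= k)%N by rewrite addn1.
  exact: (class_C_is_derive u oU Ux (CG j 1%N j1)).
- by move=> x [_ /interior_subset].
by exists V; split=> //; apply: subset_trans VU' _ => x [].
Qed.

Lemma inv_power_integral_cover U f (al : R) (I : choiceType) (s : seq I) (V : I -> set rV) K :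
  open U -> class_C 0 U f -> measurable K ->
  (forall i, i \in s -> [/\ open (V i), V i `<=` U &
    (\int[lebesgue_rV R n.+1]_(x in V i) inv_power f al x < +oo)%E]) ->
  (forall x, K x -> exists2 i, i \in s & V i x) -> 
  (\int[lebesgue_rV R n.+1]_(x in K) inv_power f al x < +oo)%E.
Proof.
move=> oU [cf _]; elim: s K => [|i s IH] K mK Vs Ks.
  have -> : K = set0 by apply/seteqP; split=> // x /Ks[].
  by rewrite integral_set0.
have [oV VU V_fin] := Vs i (mem_head _ _).
have KU : K `<=` U.
  by move=> x /Ks[l ls Vl]; have [_ + _] := Vs l ls; apply.
have mf : measurable_fun K (inv_power f al : rV -> \bar R).
  by apply: measurable_inv_power => //; exact: continuous_measurable_rV KU cf.
have mV : measurable (V i) by exact: open_measurable_rV.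
have mKV : measurable (K `&` V i) by exact: measurableI.
have mKD : measurable (K `\` V i) by exact: measurableD.
have inv0 x : (0 <= inv_power f al x)%E by exact: inv_power_ge0.
have -> : K = (K `&` V i) `|` (K `\` V i) by rewrite setUIDK.
rewrite ge0_integral_setU//.
- apply: lte_add_pinfty.
    apply: le_lt_trans V_fin; apply: ge0_subset_integral => //.
    by apply: measurable_inv_power => //; exact: continuous_measurable_rV VU cf.
  apply: IH => // [l ls|x [Kx nVx]]; first by apply: Vs; rewrite inE ls orbT.
  have [l] := Ks x Kx; rewrite inE => /orP[/eqP-> //|ls Vl]; by exists l.
- by rewrite setUIDK.
- by apply/disj_setPLR => x /= [_ Vx] [].
Qed.

End local_integrability.

(** In dimension [0] there is no line to integrate along; the space is a single point of mass [1],
    where the norm bound forces [f] to be nonzero. *)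
Lemma inv_power_integrable_rV0 (R : realType) (K : set 'rV[R]_0) (b0 alpha : R)
    (f : 'rV[R]_0 -> R) : K !=set0 -> 0 < b0 -> (b0%:E <= supnorm K f)%E ->
  (lebesgue_rV R 0).-integrable K (inv_power f alpha).
Proof.
move=> [x0 Kx0] b0_gt0 norm_f.
have eq0 (x y : 'rV[R]_0) : x = y by apply/rowP => -[].
have -> : K = setT by apply/seteqP; split=> // x _; rewrite (eq0 x x0).
have f0 : f x0 != 0.
  apply: contraTneq norm_f => fx0; rewrite -ltNge.
  apply: (@le_lt_trans _ _ 0%E); last by rewrite lte_fin.
  by apply: ge_ereal_sup => _ [x _ <-]; rewrite (eq0 x x0) fx0 normr0.
have -> : inv_power f alpha = cst (`|f x0| `^ (- alpha))%:E.
  by apply/funext => x; rewrite /inv_power (eq0 x x0) (negPf f0).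
apply/integrableP; split; first exact: measurable_cst.
under eq_integral do rewrite /= ger0_norm ?powR_ge0//.
have lamT : (lebesgue_rV R 0 setT < +oo)%E.
  have -> : lebesgue_rV R 0 setT = 1%E by exact: diracT.
  exact: ltry.
rewrite integral_cst//; apply: lte_mul_pinfty; [|by []|exact: lamT].
by rewrite lee_fin powR_ge0.
Qed.

Theorem theorem7p5 (R : realType) (n d : nat) (L K : set 'rV[R]_n)
    (mu : nat -> R) (M0 b0 alpha : R) (f : 'rV[R]_n -> R)
    (convex_L : convex_body L)
    (admissible_K : admissible_set d K)
    (degree_convex : convex_body K -> d = 1%N)
    (sub_KL : K `<=` L)
    (weight_mu : admissible_weight mu)
    (mu_ge : forall j : nat, (1 <= j)%N -> j%:R <= mu j)
    (b0_gt0 : 0 < b0) (b0_lt : b0 < M0)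
    (admissible_mu : admissible_tuple mu M0 (a_const d K) b0)
    (smooth_f :
       smooth mu (Some (degreeN mu M0 (a_const d K) b0)) M0 L f)
    (norm_f : (b0%:E <= supnorm K f)%E)
    (alpha_gt0 : 0 < alpha)
    (alpha_lt : alpha < (degreeN mu M0 (a_const d K) b0)%:R^-1) :
  (lebesgue_rV R n).-integrable K (inv_power f alpha).
Proof.
have [K0 cK _] := admissible_K.
case: n L K f convex_L admissible_K degree_convex sub_KL admissible_mu smooth_f norm_f
  alpha_lt K0 cK => [|n] L K f [_ cL _] _ _ KL adm sf norm_f alpha_lt K0 cK.
  exact: inv_power_integrable_rV0 K0 b0_gt0 norm_f.
have mu0 j : (0 < j)%N -> 0 < mu j.
  by move=> j0; apply: lt_le_trans (mu_ge j j0); rewrite ltr0n.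
have mono i j : (i <= j)%N -> mu i.+1 <= mu j.+1.
  elim: j => [|j IH]; first by rewrite leqn0 => /eqP->.
  rewrite leq_eqVlt => /orP[/eqP->//|/IH/le_trans]; apply.
  exact: weight_mu.2.
have [m [degE j0m sume]] := degree_halfE mu0 adm.
have [M00 a0 _ _] := adm.
rewrite degE in sf alpha_lt.
pose j0 := index0 M0 b0.
have j0_ge : ln (M0 / b0) <= j0%:R by exact: le_index0.
have ratio_gt1 : 1 < M0 / b0 by rewrite ltr_pdivlMr ?mul1r.
have j0_gt0 : (0 < j0)%N by rewrite -(ltr0n R); apply: lt_le_trans j0_ge; exact: ln_gt0.
have m0 : (0 < m)%N by exact: leq_trans j0m.
(* This gives access to the derivatives of order [m + 1]; it rests on [m >= 1], that is, on
   [b0 < M0]. *)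
have m2 : (m.+1 <= 2 * m)%N by rewrite mul2n -addnn -addn1 leq_add2l.
have [[U [oU LU CU]] _] := sf.
have Cf k : (k <= m.+1)%N -> class_C k U f.
  by move=> km; apply: CU; exact: leq_trans m2.
have cf x : U x -> {for x, continuous f} by have [+ _] := Cf 0%N (leq0n _); apply.
have sf' : smooth mu (Some m.+1) M0 L f.
  split=> [|j jm]; first by exists U; split=> // k; exact: Cf.
  by apply: sf.2; exact: leq_trans m2.
have KU : K `<=` U by exact: subset_trans LU.
have [w0 Kw0 fw0] : exists2 w0, K w0 & b0 <= `|f w0|.
  have cnf : {within K, continuous (fun x => `|f x|)}.
    apply: continuous_in_subspaceT => x; rewrite inE => /KU/cf cfx.
    by apply: continuous_comp => //; exact: norm_continuous.
  have [w Kw wmax] := EVT_max_rV K0 cK cnf; rewrite inE in Kw; exists w => //.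
  rewrite -lee_fin (le_trans norm_f)//; apply: ge_ereal_sup => _ [x Kx <-].
  by rewrite lee_fin wmax// inE.
(* The choice [j0 >= log (M0 / b0)] turns [b0] into the form of the bound in [bang]. *)
have fw0' : M0 * expR (- j0%:R) <= `|f w0|.
  apply: le_trans fw0; rewrite expRN ler_pdivrMr ?expR_gt0// mulrC -ler_pdivrMr//.
  by rewrite -[M0 / b0]lnK ?posrE ?(lt_trans ltr01)// ler_expR.
(* The condition [K w] sits under the existential so that [choice] gives a family indexed by all
   points; off [K] any set serves. *)
have local w : exists V, K w -> [/\ open V, V w, V `<=` U &
    (\int[lebesgue_rV R n.+1]_(x in V) inv_power f alpha x < +oo)%E].
  have [Kw|nKw] := pselect (K w); last by exists set0 => /nKw.
  have wa i : `|(w0 - w) ord0 i| <= a_const d K.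
    apply: le_trans (norm_coord_le_enorm _ _) _.
    by apply: le_trans (enorm_le_diam cK Kw0 Kw) _; exact: diam_le_a_const.
  have [k km fk] := @nonzero_directional_derivative R n U L f mu M0 (a_const d K) j0 m w0 w
    oU LU cL (Cf _ (leqnn _)) sf' M00 a0 (fun j => mu0 _ (ltn0Sn j)) mono
    (introT andP (conj j0_gt0 j0m)) sume (KL _ Kw0) (KL _ Kw) wa fw0'.
  have alk : alpha * k%:R < 1.
    have m2_gt0 : 0 < (2 * m)%:R :> R by rewrite ltr0n muln_gt0.
    apply: (@le_lt_trans _ _ (alpha * (2 * m)%:R)).
      by rewrite ler_wpM2l ?(ltW alpha_gt0)// ler_nat (leq_trans km)// leq_pmull.
    by rewrite -ltr_pdivlMr// mul1r.
  have [V hV] := inv_power_near_nonzero oU (KU _ Kw) (Cf k (leq_trans km (leqnSn m))) fk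
    alpha_gt0 alk.
  by exists V.
have [V HV] := choice local.
have oV w : K w -> open (V w) by move=> /HV[].
have KV : K `<=` cover K V by move=> x Kx; exists x => //; have [] := HV x Kx.
have cK' := cK; rewrite compact_cover in cK'.
have [D DK KD] := cK' _ K V oV KV.
have mK : measurable K.
  rewrite -[K]setCK; apply: measurableC; apply: open_measurable_rV.
  by apply: closed_openC; exact: compact_closed.
apply/integrableP; split.
  by apply: measurable_inv_power => //; exact: continuous_measurable_rV KU cf.
under eq_integral do rewrite gee0_abs ?inv_power_ge0//.
apply: (@inv_power_integral_cover R n U f alpha _ (finmap.enum_fset D) V K oU (Cf 0%N _) mK) => // w wD.
by have /set_mem/HV[] := DK w wD.
Qed.
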